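(* Let $Q$ be a quiver with vertices $1,\dots,p$ and arrows $\alpha_1,\dots,\alpha_q$. (a) Let $A$ and $B$ be Euclidean representations of $Q$. Then $A\simeq_{\mathbb R}B$ if and only if $A\simeq_{\mathbb C}B$. (b) Every Euclidean representation of $Q$ is $\mathbb R$-isometric to a direct sum of $\mathbb R$-indecomposable Euclidean representations, uniquely determined up to $\mathbb R$-isometry of summands. Moreover, $$\mathrm{ind}_{\mathbb R}(Q)=\mathrm{ind}_0(Q)\cup\{A^{\mathbb R}\mid A\in\mathrm{ind}_1(Q)\},$$ i.e. the right-hand side is a complete system of non-$\mathbb R$-isometric $\mathbb R$-indecomposable Euclidean representations of $Q$. (c) The set of dimensions of $\mathbb R$-indecomposable Euclidean representations of $Q$ coincides with the set of dimensions of indecomposable unitary representations of $Q$ and is equal to $D(Q)$.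
   Context: A quiver is a finite directed graph. A unitary representation of $Q$ of dimension $d=(d_1,\dots,d_p)\in\mathbb N_0^p$ is a sequence $A=(A_{\alpha_1},\dots,A_{\alpha_q})$ with $A_\alpha\in\mathbb C^{d_j\times d_i}$ for each arrow $\alpha:i\to j$; a Euclidean representation is one with all $A_\alpha$ real (so Euclidean representations are particular unitary representations). An isometry $S:A\to B$ of unitary representations of dimension $d$ is a sequence $S=(S_1,\dots,S_p)$ of unitary $d_i\times d_i$ matrices with $S_jA_\alpha=B_\alpha S_i$ for each arrow $\alpha:i\to j$; if it exists one writes $A\simeq_{\mathbb C}B$ (''isometric''). For Euclidean representations, an $\mathbb R$-isometry is such a sequence of real orthogonal matrices; one writes $A\simeq_{\mathbb R}B$. Direct sums are taken arrow by arrow, $A\oplus B=(A_{\alpha_1}\oplus B_{\alpha_1},\dots)$, with the conventions that $M\oplus0_{0n}$ adds $n$ zero columns and $M\oplus0_{m0}$ adds $m$ zero rows. A unitary representation of dimension $d$ is indecomposable if $d\neq0$ and $A\simeq_{\mathbb C}B\oplus C$ (with $B,C$ unitary representations) implies that $B$ or $C$ has dimension $0$; a Euclidean representation of dimension $d$ is $\mathbb R$-indecomposable if $d\neq 0$ and $A\simeq_{\mathbb R}B\oplus C$ (with $B,C$ Euclidean) implies that $B$ or $C$ has dimension $0$. $\bar A=(\bar A_{\alpha_1},\dots,\bar A_{\alpha_q})$ is the complex conjugate representation; $A$ is selfconjugate if $A=\bar A$, i.e. if it is Euclidean. $\mathrm{ind}(Q)$ and $\mathrm{ind}_{\mathbb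 R}(Q)$ denote complete systems of, respectively, nonisometric indecomposable unitary representations and non-$\mathbb R$-isometric $\mathbb R$-indecomposable Euclidean representations (exactly one representative of each isometry, resp. $\mathbb R$-isometry, class). Each representation in $\mathrm{ind}(Q)$ that is isometric to a Euclidean representation is replaced by a Euclidean one; the set of these Euclidean members of $\mathrm{ind}(Q)$ is $\mathrm{ind}_0(Q)$. $\mathrm{ind}_1(Q)$ is the set consisting of all representations from $\mathrm{ind}(Q)$ that are isometric to their conjugates but not to a selfconjugate representation, together with one representation from each pair $\{A,B\}\subset\mathrm{ind}(Q)$ such that $A\not\simeq_{\mathbb C}\bar A\simeq_{\mathbb C}B$. For a unitary representation $A$ of dimension $d$, $A^{\mathbb R}=(A^{\mathbb R}_{\alpha_1},\dots,A^{\mathbb R}_{\alpha_q})$ is the Euclidean representation of dimension $2d$ in which $A^{\mathbb R}_\alpha$ is obtained from $A_\alpha$ by replacing each entry $a+bi$ ($a,b\in\mathbb R$) by the $2\times2$ block $\begin{bmatrix}a&b\\-b&a\end{bmatrix}$. $M_Q=[m_{ij}]$ is the $p\times p$ matrix in which $m_{ij}$ is the number of arrows $i\to j$ or $i\leftarrow j$ (each loop at $i$ counted once in $m_{ii}$); $\mathrm{supp}(z)$ is the full subquiver of $Q$ with vertex set $\{i\mid z_i\ne0\}$; $e_i$ is the $i$th unit vector; $\ge$ is componentwise. $D(Q)\subset\mathbb N_0^p$ consists of $e_1,\dots,e_p$, all $e_i+e_j$ with $m_{ij}=1$, and all nonzero $z$ with connected $\mathrm{supp}(z)\notin\{\bullet,\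 \bullet\to\bullet\}$ (a single vertex without arrows; two vertices joined by exactly one arrow and with no other arrows) such that $zM_Q\ge z$. *)

(* Defs.v *)
From mathcomp Require Import all_boot all_order all_algebra.
From mathcomp Require Import boolp classical_sets reals.
From mathcomp.real_closed Require Import complex.

Set Implicit Arguments.
Unset Strict Implicit.
Unset Printing Implicit Defensive.

Import Order.TTheory GRing.Theory Num.Theory.

Local Open Scope ring_scope.
Local Open Scope classical_set_scope.

Record quiver (p q : nat) := Quiver { src : 'I_q -> 'I_p; tgt : 'I_q -> 'I_p }.

Section Representations.
Variables (C : numClosedFieldType) (p q : nat) (Q : quiver p q).

(* The dimension is a field of the record, so that representations of all
   dimensions form one type. *)
Record rep := Rep {
  rdim : 'I_p -> nat;
  rmat : forall a : 'I_q, 'M[C]_(rdim (tgt Q a), rdim (src Q a)) }.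

Implicit Types A B : rep.

Definition euclidean A := forall a, rmat A a \is a realmx.

Definition rep_conj A : rep :=
  @Rep (rdim A) (fun a => map_mx (@Num.conj C) (rmat A a)).

Definition selfconjugate A := forall a, rmat A a = rmat (rep_conj A) a.

Definition intertwines A B (S : forall i, 'M[C]_(rdim B i, rdim A i)) :=
  forall a, S (tgt Q a) *m rmat A a = rmat B a *m S (src Q a).

(* [unitarymx] and [S *m S^T = 1%:M] make sense for rectangular [S]; they mean
   unitary and orthogonal because the dimensions are required to be equal. *)
Definition isometric A B :=
  rdim A =1 rdim B /\
  exists S : forall i, 'M[C]_(rdim B i, rdim A i),
    (forall i, S i \is unitarymx) /\ intertwines S.

Definition R_isometric A B :=
  rdim A =1 rdim B /\
  exists S : forall i, 'M[C]_(rdim B i, rdim A i),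
    (forall i, S i \is a realmx /\ S i *m (S i)^T = 1%:M) /\ intertwines S.

Definition rep0 : rep := @Rep (fun=> 0%N) (fun=> 0).

Definition dsum A B : rep :=
  @Rep (fun i => rdim A i + rdim B i)%N
       (fun a => block_mx (rmat A a) 0 0 (rmat B a)).

Definition dim0 A := forall i, rdim A i = 0%N.

Definition indecomposable A :=
  ~ dim0 A /\ forall B B', isometric A (dsum B B') -> dim0 B \/ dim0 B'.

Definition R_indecomposable A :=
  [/\ euclidean A, ~ dim0 A
    & forall B B', euclidean B -> euclidean B' ->
        R_isometric A (dsum B B') -> dim0 B \/ dim0 B'].

Definition half_ord n (r : 'I_n.*2) : 'I_n :=
  Ordinal (etrans (ltn_half_double r n) (ltn_ord r)).

(* Rows 2k, 2k+1 and columns 2l, 2l+1 carry the block [[a, b], [-b, a]] of the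
   entry a + bi at (k, l). *)
Definition realify_mx m n (M : 'M[C]_(m, n)) : 'M[C]_(m.*2, n.*2) :=
  \matrix_(r, c)
    let z := M (half_ord r) (half_ord c) in
    if odd r == odd c then 'Re z else if odd r then - 'Im z else 'Im z.

Definition realify A : rep :=
  @Rep (fun i => (rdim A i).*2) (fun a => realify_mx (rmat A a)).

Definition complete_system (P : set rep) (iso : rep -> rep -> Prop)
    (X : set rep) :=
  [/\ X `<=` P,
      forall A, P A -> exists2 B, X B & iso A B
    & forall A B, X A -> X B -> iso A B -> A = B].

Definition is_ind (I : set rep) :=
  complete_system indecomposable isometric I /\
  forall A, I A -> (exists2 B, euclidean B & isometric A B) -> euclidean A.

Definition is_ind_R (I : set rep) :=
  complete_system R_indecomposable R_isometric I.

Definition ind0 (I : set rep) := [set A | I A /\ euclidean A].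

Definition quaternionic (I : set rep) :=
  [set A | [/\ I A, isometric A (rep_conj A)
             & ~ exists2 B, selfconjugate B & isometric A B]].

Definition conj_pair (I : set rep) A B :=
  [/\ I A, I B, ~ isometric A (rep_conj A) & isometric (rep_conj A) B].

(* [P] is the set of representatives chosen from the conjugate pairs; as it is
   not canonical, being ind_1 is a property of a set. *)
Definition is_ind1 (I I1 : set rep) :=
  exists P : set rep,
    [/\ P `<=` [set A | exists B, conj_pair I A B],
        forall A B, conj_pair I A B -> (P A <-> ~ P B)
      & I1 = quaternionic I `|` P].

End Representations.

Section Dimensions.
Variables (p q : nat) (Q : quiver p q).
Implicit Types z : 'I_p -> nat.

Definition arrow_count (i j : 'I_p) : nat :=
  #|[set a | (src Q a == i) && (tgt Q a == j)
             || (src Q a == j) && (tgt Q a == i)]%SET|.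

Definition arrow_mx : 'M[nat]_p := \matrix_(i, j) arrow_count i j.

Definition unit_vec (i : 'I_p) : 'I_p -> nat := fun k => (k == i).

Definition supp_vertices z : {set 'I_p} := [set i | z i != 0%N]%SET.

Definition supp_arrows z : {set 'I_q} :=
  [set a | (src Q a \in supp_vertices z) && (tgt Q a \in supp_vertices z)]%SET.

Definition supp_adj z : rel 'I_p := fun i j =>
  [exists a in supp_arrows z, (src Q a == i) && (tgt Q a == j)
                              || (src Q a == j) && (tgt Q a == i)].

Definition supp_connected z :=
  {in supp_vertices z &, forall i j, connect (supp_adj z) i j}.

Definition supp_point z :=
  #|supp_vertices z| = 1%N /\ supp_arrows z = finset.set0.

Definition supp_segment z :=
  #|supp_vertices z| = 2%N /\
  exists2 a, supp_arrows z = [set a]%SET & src Q a != tgt Q a.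

Definition DQ : set ('I_p -> nat) := [set z |
  [\/ exists i, z = unit_vec i,
      exists i j, arrow_mx i j = 1%N /\
                  z = (fun k => unit_vec i k + unit_vec j k)%N
    | [/\ exists i, z i <> 0%N,
          supp_connected z,
          ~ supp_point z,
          ~ supp_segment z
        & forall i, (z i <= ((\row_j z j) *m arrow_mx) ord0 i)%N]]].

End Dimensions.

(* Main.v *)
(* A Hermitian projection commuting with all matrices of a representation and
   with their adjoints splits off a direct summand, over C and over R alike.
   Hence a Hermitian endomorphism of an indecomposable representation is scalar
   and T^* T is scalar for every homomorphism T out of it: a nonzero
   homomorphism between indecomposables is a multiple of an isometry.  Together
   with a cancellation law (close the feedback loop of a unitary block matrix)
   this gives unique decomposition over both fields.

   (a) If X + iY is a unitary isometry of Euclidean representations, X + tY is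
   an invertible real homomorphism for some real t; its polar part is an
   orthogonal isometry.

   (b) A^R is unitarily isometric to the sum of A and its conjugate.  An
   indecomposable B embedded in an R-indecomposable E yields a nonzero real
   homomorphism to E from B, if B is Euclidean, and from B^R otherwise.

   (c) A vertex i with (zM)_i < z_i carries a vector killed by all arrows at i,
   and a singular pair of vectors splits off a segment, so dimensions of
   indecomposables lie in D(Q).  Conversely, for z in D(Q) prescribe the singular
   vectors of each matrix at both ends of its arrow, with distinct singular
   values.  The inequality z <= zM provides enough of them to span the space at
   each vertex, and as soon as two half-edges meet at a vertex they can be
   chosen so that every self-adjoint endomorphism is scalar there. *)

Require Import Defs.
From mathcomp Require Import all_boot all_order all_algebra.
From mathcomp Require Import boolp classical_sets reals.
From mathcomp.real_closed Require Import complex.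
From mathcomp Require Import zify ring.

Set Implicit Arguments.
Unset Strict Implicit.
Unset Printing Implicit Defensive.

Import Order.TTheory GRing.Theory Num.Theory.

Local Open Scope ring_scope.
Local Open Scope sesquilinear_scope.

(** * Matrices over C and R *)

Section Matrices.
Variable C : numClosedFieldType.

(** The obstacle is the real field: the endomorphisms of an R-indecomposable may form the reals, the
    complex numbers or the quaternions, so they need not be scalar. Hermitian ones are, over either
    field, because a real function of a real Hermitian matrix is real. Hence a homomorphism T is
    only examined through T^* T, and which of the three cases holds never matters. Likewise block
    elimination would cancel a summand only up to isomorphism; the feedback keeps the result
    isometric.

    In (c) all prescribed matrices have integer entries, so one representation, Euclidean and
    indecomposable already over C, serves both fields. A vertex met by a single half-edge has no
    second frame to compare with. There the inequality forces the matrix on this half-edge to be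
    injective, and the scalar is imported from the other end. This fails only if both ends are of
    this kind, and then the support is a segment. *)

Lemma adjmxM m n k (A : 'M[C]_(m, n)) (B : 'M_(n, k)) :
  (A *m B)^t* = B^t* *m A^t*.
Proof. by rewrite trmx_mul map_mxM. Qed.

Lemma adjmxD m n (A B : 'M[C]_(m, n)) : (A + B)^t* = A^t* + B^t*.
Proof. by rewrite linearD map_mxD. Qed.

Lemma adjmxN m n (A : 'M[C]_(m, n)) : (- A)^t* = - A^t*.
Proof. by rewrite linearN map_mxN. Qed.

Lemma adjmxB m n (A B : 'M[C]_(m, n)) : (A - B)^t* = A^t* - B^t*.
Proof. by rewrite adjmxD adjmxN. Qed.

Lemma adjmxZ m n a (A : 'M[C]_(m, n)) : (a *: A)^t* = a^* *: A^t*.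
Proof. by rewrite linearZ map_mxZ. Qed.

Lemma adjmx1 n : (1%:M : 'M[C]_n)^t* = 1%:M.
Proof. by rewrite trmx1 map_mx1. Qed.

Lemma adjmx0 m n : (0 : 'M[C]_(m, n))^t* = 0.
Proof. by rewrite trmx0 map_mx0. Qed.

Lemma adjmx_scalar n (a : C) : (a%:M : 'M[C]_n)^t* = (a^*)%:M.
Proof. by rewrite tr_scalar_mx map_scalar_mx. Qed.

Lemma adjmx_block m1 m2 n1 n2 (a : 'M[C]_(m1, n1)) (b : 'M_(m1, n2)) c
    (d : 'M_(m2, n2)) :
  (block_mx a b c d)^t* = block_mx (a^t*) (c^t*) (b^t*) (d^t*).
Proof. by rewrite tr_block_mx map_block_mx. Qed.

Lemma adjmx_col m1 m2 n (a : 'M[C]_(m1, n)) (b : 'M_(m2, n)) :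
  (col_mx a b)^t* = row_mx (a^t*) (b^t*).
Proof. by rewrite tr_col_mx map_row_mx. Qed.

Lemma adjmx_row m n1 n2 (a : 'M[C]_(m, n1)) (b : 'M_(m, n2)) :
  (row_mx a b)^t* = col_mx (a^t*) (b^t*).
Proof. by rewrite tr_row_mx map_col_mx. Qed.

Lemma adjmx_eq0 m n (A : 'M[C]_(m, n)) : (A^t* == 0) = (A == 0).
Proof.
apply/eqP/eqP => [A0|->]; last by rewrite adjmx0.
by rewrite -[A]trmxCK A0 adjmx0.
Qed.

Lemma mulmx_adj_eq0 m n (A : 'M[C]_(m, n)) : A^t* *m A = 0 -> A = 0.
Proof.
move=> /matrixP A0; apply/matrixP => i j; have := A0 j j; rewrite !mxE.
under eq_bigr do rewrite !mxE mulrC -normCK.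
move/eqP; rewrite psumr_eq0 => [|k _]; last by rewrite exprn_ge0.
by move=> /allP/(_ i (mem_index_enum _)); rewrite expf_eq0/= normr_eq0 => /eqP.
Qed.

Lemma mulmx1C_eq m n (A : 'M[C]_(m, n)) (B : 'M_(n, m)) :
  m = n -> A *m B = 1%:M -> B *m A = 1%:M.
Proof. by move=> mn; move: A B; rewrite mn => A B; exact: mulmx1C. Qed.

Lemma mulmx1_dim m n (A : 'M[C]_(m, n)) (B : 'M_(n, m)) :
  A *m B = 1%:M -> (m <= n)%N.
Proof.
move=> AB; have := mxrankM_maxl A B; rewrite AB mxrank1 => mA.
exact: leq_trans mA (rank_leq_col _).
Qed.

Lemma mulmx1_dim_eq m n (A : 'M[C]_(m, n)) (B : 'M_(n, m)) :
  A *m B = 1%:M -> B *m A = 1%:M -> m = n.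
Proof. by move=> /mulmx1_dim mn /mulmx1_dim nm; apply/eqP; rewrite eqn_leq mn. Qed.

(* A flag [K] treats both base fields at once: [K = true] restricts to real
   matrices, [K = false] imposes nothing. *)
Definition overK (K : bool) m n (A : 'M[C]_(m, n)) := K -> A \is a realmx.

Lemma realmxP m n (A : 'M[C]_(m, n)) :
  reflect (map_mx (@Num.conj C) A = A) (A \is a realmx).
Proof.
apply: (iffP idP) => [|AA]; first exact: realmxC.
by apply/mxOverP => i j; apply/CrealP; rewrite -[in RHS]AA mxE.
Qed.

Lemma overKM K m n k (A : 'M[C]_(m, n)) (B : 'M_(n, k)) :
  overK K A -> overK K B -> overK K (A *m B).
Proof.
move=> rA rB k1; apply/realmxP; rewrite map_mxM.
by rewrite (realmxP _ (rA k1)) (realmxP _ (rB k1)).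
Qed.

Lemma overK_adj K m n (A : 'M[C]_(m, n)) : overK K A -> overK K (A^t*).
Proof.
move=> rA k1; apply/realmxP/matrixP => i j; rewrite !mxE.
have /matrixP/(_ j i) := realmxP _ (rA k1).
by rewrite mxE conjCK => /esym.
Qed.

Lemma overKD K m n (A B : 'M[C]_(m, n)) :
  overK K A -> overK K B -> overK K (A + B).
Proof. by move=> rA rB k1; apply: realmxD; [apply: rA | apply: rB]. Qed.

Lemma overKN K m n (A : 'M[C]_(m, n)) : overK K A -> overK K (- A).
Proof.
by move=> rA k1; apply/realmxP; rewrite map_mxN (realmxP _ (rA k1)).
Qed.

Lemma overKZ K m n a (A : 'M[C]_(m, n)) :
  a \is Num.real -> overK K A -> overK K (a *: A).
Proof.
move=> ra rA k1; apply/realmxP; rewrite map_mxZ (realmxP _ (rA k1)).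
by rewrite /= (CrealP ra).
Qed.

Lemma overK_scalar K n (a : C) : a \is Num.real -> overK K (a%:M : 'M_n).
Proof. by move=> ra k1; apply/realmxP; rewrite map_scalar_mx/= (CrealP ra). Qed.

Lemma overK1 K n : overK K (1%:M : 'M[C]_n).
Proof. exact/overK_scalar/real1. Qed.

Lemma overK0 K m n : overK K (0 : 'M[C]_(m, n)).
Proof. by move=> k1; apply/realmxP; rewrite map_mx0. Qed.

Lemma overK_row K m n1 n2 (a : 'M[C]_(m, n1)) (b : 'M_(m, n2)) :
  overK K (row_mx a b) <-> overK K a /\ overK K b.
Proof.
split=> [rab|[ra rb] k1]; last first.
  by apply/realmxP; rewrite map_row_mx (realmxP _ (ra k1)) (realmxP _ (rb k1)).
by split=> k1; apply/realmxP; have /realmxP := rab k1; rewrite map_row_mx => /eq_row_mx[].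
Qed.

Lemma overK_col K m1 m2 n (a : 'M[C]_(m1, n)) (b : 'M_(m2, n)) :
  overK K (col_mx a b) <-> overK K a /\ overK K b.
Proof.
split=> [rab|[ra rb] k1]; last first.
  by apply/realmxP; rewrite map_col_mx (realmxP _ (ra k1)) (realmxP _ (rb k1)).
by split=> k1; apply/realmxP; have /realmxP := rab k1; rewrite map_col_mx => /eq_col_mx[].
Qed.

Lemma adj_mulmx_scal (n : nat) (v : 'cV[C]_n) :
  exists2 s : C, v^t* *m v = s%:M & (v != 0 -> 0 < s).
Proof.
exists ((v^t* *m v) 0 0); first exact: mx11_scalar.
move=> v0; rewrite lt_neqAle; apply/andP; split.
  apply: contra v0 => /eqP s0; apply/eqP/mulmx_adj_eq0.
  by rewrite [LHS]mx11_scalar -s0 raddf0.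
rewrite mxE sumr_ge0// => k _; rewrite !mxE mulrC -normCK; exact: exprn_ge0.
Qed.

(** A nonzero column of [P] is fixed by [P]; normalised to [w], it gives the Hermitian projection
    [P - w *m w^t*], of smaller rank because it kills [w]. Normalising divides by a positive square
    root, so a real [P] yields a real [V]. *)
Lemma proj_split K n (P : 'M[C]_n) :
  overK K P -> P^t* = P -> P *m P = P ->
  exists r (V : 'M_(n, r)), [/\ overK K V, V^t* *m V = 1%:M & V *m V^t* = P].
Proof.
have [k] := ubnP (\rank P); elim: k P => // k IH P; rewrite ltnS => rPk rP hP pP.
have [P0|/eqP P0] := P =P 0.
  exists 0%N, 0; split; first exact: overK0.
    by rewrite mulmx0; apply/matrixP => -[].
  by rewrite mul0mx P0.
have [j Pj] : exists j, col j P != 0.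
  apply/existsP; apply: contraR P0 => /existsPn allz; apply/eqP/matrixP => i j.
  by have /negbNE/eqP/matrixP/(_ i 0) := allz j; rewrite !mxE.
pose v := col j P; have Pv : P *m v = v by rewrite /v colE mulmxA pP.
have [s vv /(_ Pj) s0] := adj_mulmx_scal v.
pose w := (sqrtC s)^-1 *: v.
have rs : sqrtC s \is Num.real by rewrite ger0_real// sqrtC_ge0 ltW.
have ww : w^t* *m w = 1%:M.
  rewrite /w adjmxZ -scalemxAl -scalemxAr vv scalerA.
  rewrite (CrealP _) ?rpredV// -invfM -expr2 sqrtCK scale_scalar_mx mulVf//.
  exact: lt0r_neq0.
have Pw : P *m w = w by rewrite /w -scalemxAr Pv.
have wP : w^t* *m P = w^t* by rewrite -{1}hP -adjmxM Pw.
have rw : overK K w.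
  apply: overKZ; rewrite ?rpredV// => k1; apply/realmxP/matrixP => x y.
  by rewrite !mxE; have /realmxP/matrixP/(_ x j) := rP k1; rewrite mxE.
pose P' := P - w *m w^t*.
have P'w : P' *m w = 0 by rewrite mulmxBl -mulmxA ww Pw mulmx1 subrr.
have [||||r [V [rV VV VVP]]] := IH P'.
- apply: leq_trans rPk; apply: rank_ltmx; apply/andP; split.
    by rewrite addmx_sub ?submx_refl// eqmx_opp -wP mulmxA submxMl.
  apply/negP => /submxP[D PD].
  have : P *m w = 0 by rewrite PD -mulmxA P'w mulmx0.
  rewrite Pw => w0; move: ww; rewrite w0 mulmx0 => /matrixP/(_ 0 0).
  by rewrite !mxE => /eqP; rewrite eq_sym oner_eq0.
- by apply: overKD => //; apply/overKN/overKM => //; apply: overK_adj.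
- by rewrite adjmxB hP adjmxM trmxCK.
- rewrite {2}/P' mulmxBr mulmxA P'w mul0mx subr0 mulmxBl pP -mulmxA wP.
  by [].
exists (1 + r)%N, (row_mx w V).
have wV : w^t* *m V = 0.
  have : w^t* *m P' = 0 by rewrite mulmxBr wP mulmxA ww mul1mx subrr.
  by rewrite -VVP mulmxA => /(congr1 (mulmx^~ V)); rewrite -mulmxA VV mulmx1 mul0mx.
split; first by apply/overK_row.
  rewrite adjmx_row mul_col_row ww VV wV -[V^t* *m w]trmxCK adjmxM trmxCK wV.
  by rewrite adjmx0 -scalar_mx_block.
by rewrite adjmx_row mul_row_col VVP /P' addrC subrK.
Qed.

(* With [T = 1%:M] this says that a function of a Hermitian matrix does not
   depend on the chosen diagonalisation. *)
Lemma funcalc_intertwine (f : C -> C) m n (T : 'M[C]_(m, n)) (U : 'M_n) d (V : 'M_m) e :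
  U *m U^t* = 1%:M -> V *m V^t* = 1%:M ->
  T *m (U^t* *m diag_mx d *m U) = (V^t* *m diag_mx e *m V) *m T ->
  T *m (U^t* *m diag_mx (map_mx f d) *m U) =
    (V^t* *m diag_mx (map_mx f e) *m V) *m T.
Proof.
move=> UU VV TH; have U'U := mulmx1C UU; have V'V := mulmx1C VV.
have WF (W : 'M_(m, n)) : W *m diag_mx d = diag_mx e *m W ->
    W *m diag_mx (map_mx f d) = diag_mx (map_mx f e) *m W.
  move=> WD; apply/matrixP => i j; have /matrixP/(_ i j) := WD.
  rewrite !mul_mx_diag !mul_diag_mx !mxE.
  have [->|W0] := eqVneq (W i j) 0; first by rewrite !(mul0r, mulr0).
  by rewrite mulrC => /(mulIf W0) ->; rewrite mulrC.
pose W := V *m T *m U^t*.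
have WD : W *m diag_mx d = diag_mx e *m W.
  have := congr1 (fun M => V *m M *m U^t*) TH.
  by rewrite !mulmxA -[_ *m U *m _]mulmxA UU mulmx1 VV mul1mx -!mulmxA.
have TE : T = V^t* *m W *m U by rewrite !mulmxA V'V mul1mx -mulmxA U'U mulmx1.
clearbody W; rewrite TE !mulmxA -(mulmxA _ U (U^t*)) UU mulmx1.
rewrite -(mulmxA _ V (V^t*)) VV mulmx1 -(mulmxA (V^t*) W) (WF _ WD).
by rewrite !mulmxA.
Qed.

Lemma herm_spectral n (H : 'M[C]_n) (U := spectralmx H) (d := spectral_diag H) :
  H^t* = H ->
  [/\ U *m U^t* = 1%:M, H = U^t* *m diag_mx d *m U & d \is a realmx].
Proof.
move=> hH; have hsH : H \is hermsymmx.
  by apply/is_hermitianmxP; rewrite expr0 scale1r.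
split; first exact/unitarymxP/spectral_unitarymx.
  rewrite -invmx_unitary ?spectral_unitarymx//.
  exact/orthomx_spectralP/hermitian_normalmx.
exact: hermitian_spectral_diag_real.
Qed.

(** [U] may be complex even if [H] is real. Conjugating [U] gives a second diagonalisation of [H]
    with the same real [d]; independence of the diagonalisation makes the result equal to its own
    conjugate. *)
Lemma funcalc_real K n (H U : 'M[C]_n) d (f : C -> C) : overK K H ->
  U *m U^t* = 1%:M -> H = U^t* *m diag_mx d *m U -> d \is a realmx ->
  (forall x, x \is Num.real -> f x \is Num.real) ->
  overK K (U^t* *m diag_mx (map_mx f d) *m U).
Proof.
move=> rH UU HE rd rf k1.
have dE (e : 'rV_n) : e \is a realmx -> map_mx (@Num.conj C) (diag_mx e) = diag_mx e.
  move=> /realmxP re; apply/matrixP => i j; rewrite !mxE rmorphMn/=.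
  by have /matrixP/(_ 0 i) := re; rewrite mxE => ->.
have UE : (map_mx (@Num.conj C) U)^t* = map_mx (@Num.conj C) (U^t*).
  by apply/matrixP => i j; rewrite !mxE.
have VV : map_mx (@Num.conj C) U *m (map_mx (@Num.conj C) U)^t* = 1%:M.
  by rewrite UE -map_mxM UU map_mx1.
apply/realmxP; rewrite !map_mxM dE; last first.
  by apply/mxOverP => i j; rewrite mxE rf//; exact: (mxOverP rd).
have /realmxP := rH k1; rewrite {1}HE !map_mxM dE// HE => HH.
have := @funcalc_intertwine f _ _ 1%:M _ d _ d VV UU.
by rewrite UE !mul1mx !mulmx1; apply.
Qed.

End Matrices.

(** * Homomorphisms and indecomposable representations *)

Section StarHomomorphisms.
Variables (C : numClosedFieldType) (p q : nat) (Q : quiver p q).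
Implicit Types (K : bool) (A B D E : rep C Q).

Definition fam A B := forall i, 'M[C]_(rdim B i, rdim A i).

Definition repK K A := forall a, overK K (rmat A a).

(* Unitary intertwiners also intertwine the adjoints; asking this of arbitrary
   families makes the homomorphisms closed under adjunction. *)
Definition homK K A B (S : fam A B) :=
  [/\ forall a, S (tgt Q a) *m rmat A a = rmat B a *m S (src Q a),
      forall a, S (src Q a) *m (rmat A a)^t* = (rmat B a)^t* *m S (tgt Q a)
    & forall i, overK K (S i)].

Lemma homK_adj K A B (S : fam A B) : homK K S -> homK K (fun i => (S i)^t*).
Proof.
move=> [S1 S2 S3]; split=> [a|a|i]; last exact: overK_adj.
  by have := congr1 (fun M => M^t*) (S2 a); rewrite !adjmxM !trmxCK => ->.
by have := congr1 (fun M => M^t*) (S1 a); rewrite !adjmxM => ->.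
Qed.

Lemma homK_comp K A B D (S : fam A B) (T : fam B D) :
  homK K S -> homK K T -> homK K (fun i => T i *m S i).
Proof.
move=> [S1 S2 S3] [T1 T2 T3]; split=> [a|a|i]; last exact: overKM.
  by rewrite -mulmxA S1 !mulmxA T1.
by rewrite -mulmxA S2 !mulmxA T2.
Qed.

Lemma homKD K A B (S T : fam A B) :
  homK K S -> homK K T -> homK K (fun i => S i + T i).
Proof.
move=> [S1 S2 S3] [T1 T2 T3]; split=> [a|a|i]; last exact: overKD.
  by rewrite mulmxDl mulmxDr S1 T1.
by rewrite mulmxDl mulmxDr S2 T2.
Qed.

Lemma homKZ K A B c (S : fam A B) :
  c \is Num.real -> homK K S -> homK K (fun i => c *: S i).
Proof.
move=> rc [S1 S2 S3]; split=> [a|a|i]; last exact: overKZ.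
  by rewrite -scalemxAl S1 scalemxAr.
by rewrite -scalemxAl S2 scalemxAr.
Qed.

Lemma homKN K A B (S : fam A B) : homK K S -> homK K (fun i => - S i).
Proof.
move=> [S1 S2 S3]; split=> [a|a|i]; last exact: overKN.
  by rewrite mulNmx mulmxN S1.
by rewrite mulNmx mulmxN S2.
Qed.

Lemma homK1 K A : homK K (fun i => 1%:M : 'M_(rdim A i)).
Proof. by split=> *; rewrite ?mul1mx ?mulmx1//; exact: overK1. Qed.

Lemma homK_false K A B (S : fam A B) : homK K S -> homK false S.
Proof. by move=> [S1 S2 _]. Qed.

Definition isoK K A B := exists S : fam A B,
  [/\ homK K S, forall i, (S i)^t* *m S i = 1%:M
    & forall i, S i *m (S i)^t* = 1%:M].

Definition embK K A B := exists S : fam A B,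
  homK K S /\ forall i, (S i)^t* *m S i = 1%:M.

Lemma isoK_refl K A : isoK K A A.
Proof.
exists (fun i => 1%:M); split; first exact: homK1.
  by move=> i; rewrite mulmx1 adjmx1.
by move=> i; rewrite mul1mx adjmx1.
Qed.

Lemma isoK_sym K A B : isoK K A B -> isoK K B A.
Proof.
move=> [S [hS S1 S2]]; exists (fun i => (S i)^t*); split; first exact: homK_adj.
  by move=> i; rewrite trmxCK.
by move=> i; rewrite trmxCK.
Qed.

Lemma embK_trans K A B D : embK K A B -> embK K B D -> embK K A D.
Proof.
move=> [S [hS S1]] [T [hT T1]]; exists (fun i => T i *m S i).
split; first exact: homK_comp.
by move=> i; rewrite adjmxM mulmxA -(mulmxA _ _ (T i)) T1 mulmx1.
Qed.

Lemma isoK_trans K A B D : isoK K A B -> isoK K B D -> isoK K A D.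
Proof.
move=> [S [hS S1 S2]] [T [hT T1 T2]]; exists (fun i => T i *m S i).
split; first exact: homK_comp.
  by move=> i; rewrite adjmxM mulmxA -(mulmxA _ _ (T i)) T1 mulmx1.
by move=> i; rewrite adjmxM mulmxA -(mulmxA _ (S i)) S2 mulmx1.
Qed.

Lemma isoK_emb K A B : isoK K A B -> embK K A B.
Proof. by move=> [S [hS S1 S2]]; exists S. Qed.

Lemma isoK_false K A B : isoK K A B -> isoK false A B.
Proof. by move=> [S [/homK_false hS S1 S2]]; exists S. Qed.

Lemma isoK_dim K A B : isoK K A B -> rdim A =1 rdim B.
Proof.
by move=> [S [_ S1 S2]] i; exact: mulmx1_dim_eq (S1 i) (S2 i).
Qed.

Lemma embK_dim K A B i : embK K A B -> (rdim A i <= rdim B i)%N.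
Proof. by move=> [S [_ S1]]; exact: mulmx1_dim (S1 i). Qed.

Lemma embK_iso K A B : rdim A =1 rdim B -> embK K A B -> isoK K A B.
Proof.
move=> dAB [S [hS S1]]; exists S; split=> // i.
by apply: mulmx1C_eq (S1 i); exact: dAB.
Qed.

(** For unitary [S], multiply the intertwining relation by the adjoint of [S (tgt Q a)] on the left
    and that of [S (src Q a)] on the right; passing to adjoints gives the second relation in
    [homK]. *)
Lemma isometricE A B : isometric A B <-> isoK false A B.
Proof.
split=> [[dAB [S [uS iS]]]|iAB]; last first.
  split; first exact: isoK_dim iAB.
  case: iAB => S [[S1 _ _] _ SS]; exists S; split=> // i.
  exact/unitarymxP.
have SS i : S i *m (S i)^t* = 1%:M by exact/unitarymxP.
have S'S i : (S i)^t* *m S i = 1%:M by exact: mulmx1C_eq (SS i).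
exists S; split=> //; split=> // a.
have := congr1 (fun M => (S (tgt Q a))^t* *m M *m (S (src Q a))^t*) (iS a).
rewrite !mulmxA S'S mul1mx -(mulmxA _ (S (src Q a))) SS mulmx1 => E.
by have := congr1 (fun M => M^t*) E; rewrite !adjmxM !trmxCK.
Qed.

Lemma R_isometricE A B : R_isometric A B <-> isoK true A B.
Proof.
have trE m n (M : 'M[C]_(m, n)) : M \is a realmx -> M^T = M^t*.
  by move=> /realmxP MM; apply/matrixP => i j; rewrite -{1}MM !mxE.
split=> [[dAB [S [uS iS]]]|iAB]; last first.
  split; first exact: isoK_dim iAB.
  case: iAB => S [[S1 _ rS] _ SS]; exists S; split=> // i.
  by have ri := rS i isT; rewrite trE ?SS.
have /isometricE[T [[T1 T2 _] TT T'T]] : isometric A B.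
  split=> //; exists S; split=> // i; apply/unitarymxP.
  by rewrite -trE; case: (uS i).
have SS i : S i *m (S i)^t* = 1%:M by rewrite -trE; case: (uS i).
have S'S i : (S i)^t* *m S i = 1%:M by exact: mulmx1C_eq (SS i).
exists S; split=> //; split=> // [a|i _]; last by case: (uS i).
have := congr1 (fun M => (S (tgt Q a))^t* *m M *m (S (src Q a))^t*) (iS a).
rewrite !mulmxA S'S mul1mx -(mulmxA _ (S (src Q a))) SS mulmx1 => E.
by have := congr1 (fun M => M^t*) E; rewrite !adjmxM !trmxCK.
Qed.

Definition dsum_inl A B : fam A (dsum A B) := fun i => col_mx 1%:M 0.
Definition dsum_inr A B : fam B (dsum A B) := fun i => col_mx 0 1%:M.

Lemma homK_inl K A B : homK K (dsum_inl A B).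
Proof.
split=> [a|a|i] /=.
- by rewrite mul_block_col mul_col_mx mul1mx !mul0mx !mulmx0 mulmx1 !addr0.
- rewrite /= adjmx_block mul_block_col mul_col_mx !adjmx0.
  by rewrite mul1mx !mul0mx !mulmx0 mulmx1 !addr0.
- by apply/overK_col; split; [exact: overK1 | exact: overK0].
Qed.

Lemma homK_inr K A B : homK K (dsum_inr A B).
Proof.
split=> [a|a|i] /=.
- by rewrite mul_block_col mul_col_mx mul1mx !mul0mx !mulmx0 mulmx1 !add0r.
- rewrite /= adjmx_block mul_block_col mul_col_mx !adjmx0.
  by rewrite mul1mx !mul0mx !mulmx0 mulmx1 !add0r.
- by apply/overK_col; split; [exact: overK0 | exact: overK1].
Qed.

Lemma dsum_inE A B i :
  [/\ (dsum_inl A B i)^t* *m dsum_inl A B i = 1%:M,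
      (dsum_inr A B i)^t* *m dsum_inr A B i = 1%:M,
      (dsum_inl A B i)^t* *m dsum_inr A B i = 0,
      (dsum_inr A B i)^t* *m dsum_inl A B i = 0
    & dsum_inl A B i *m (dsum_inl A B i)^t* +
      dsum_inr A B i *m (dsum_inr A B i)^t* = 1%:M].
Proof.
rewrite /dsum_inl /dsum_inr !adjmx_col !mul_row_col !mul_col_row !adjmx1 !adjmx0.
rewrite !(mul1mx, mul0mx, mulmx1, mulmx0, addr0, add0r); split=> //.
by rewrite add_block_mx !(addr0, add0r) -scalar_mx_block.
Qed.

Lemma isoK_dsumP K E A B :
  isoK K E (dsum A B) <->
  exists (V : fam A E) (W : fam B E),
    [/\ homK K V, homK K W,
        forall i, (V i)^t* *m V i = 1%:M, forall i, (W i)^t* *m W i = 1%:M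
      & forall i, V i *m (V i)^t* + W i *m (W i)^t* = 1%:M].
Proof.
split=> [[S [hS S1 S2]]|[V [W [hV hW VV WW VW]]]].
  exists (fun i => (S i)^t* *m dsum_inl A B i).
  exists (fun i => (S i)^t* *m dsum_inr A B i); split=> [||i|i|i].
  - exact: homK_comp (homK_inl _ _ _) (homK_adj hS).
  - exact: homK_comp (homK_inr _ _ _) (homK_adj hS).
  - rewrite adjmxM trmxCK mulmxA -(mulmxA _ (S i)) S2 mulmx1.
    by case: (dsum_inE A B i).
  - rewrite adjmxM trmxCK mulmxA -(mulmxA _ (S i)) S2 mulmx1.
    by case: (dsum_inE A B i).
  - rewrite !adjmxM trmxCK !mulmxA -mulmxDl -!(mulmxA ((S i)^t*)) -mulmxDr.
    by case: (dsum_inE A B i) => _ _ _ _ ->; rewrite mulmx1 S1.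
have VW0 i : (V i)^t* *m W i = 0.
  have := congr1 (fun M => (V i)^t* *m M *m W i) (VW i).
  rewrite mulmxDr mulmxDl !mulmxA VV mul1mx mulmx1 -(mulmxA _ _ (W i)) WW mulmx1.
  by move/eqP; rewrite -subr_eq0 addrK => /eqP.
have WV0 i : (W i)^t* *m V i = 0.
  by rewrite -[LHS]trmxCK adjmxM trmxCK VW0 adjmx0.
exists (fun i => dsum_inl A B i *m (V i)^t* + dsum_inr A B i *m (W i)^t*).
split=> [|i|i].
- apply: homKD; first exact: homK_comp (homK_adj hV) (homK_inl _ _ _).
  exact: homK_comp (homK_adj hW) (homK_inr _ _ _).
- have [ll rr lr rl _] := dsum_inE A B i.
  rewrite adjmxD !adjmxM !trmxCK mulmxDl !mulmxDr !mulmxA.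
  rewrite -!(mulmxA _ _ (dsum_inl A B i)) -!(mulmxA _ _ (dsum_inr A B i)).
  by rewrite ll rr lr rl !mulmx1 !mulmx0 !mul0mx addr0 add0r VW.
- have [_ _ _ _ s1] := dsum_inE A B i.
  rewrite adjmxD !adjmxM !trmxCK mulmxDl !mulmxDr !mulmxA.
  rewrite -!(mulmxA _ _ (V i)) -!(mulmxA _ _ (W i)) VV WW VW0 WV0.
  by rewrite !mulmx1 !mulmx0 !mul0mx addr0 add0r s1.
Qed.

(** [D] is the compression of [E] to the range of [P], written in an orthonormal basis [W i] of that
    range; [W] intertwines because [P] commutes with the arrows and with their adjoints. *)
Lemma homK_proj_split K E (P : fam E E) :
  repK K E -> homK K P -> (forall i, (P i)^t* = P i) ->
  (forall i, P i *m P i = P i) ->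
  exists D (W : fam D E), [/\ repK K D, homK K W,
    forall i, (W i)^t* *m W i = 1%:M & forall i, W i *m (W i)^t* = P i].
Proof.
move=> rE [P1 P2 P3] hP PP.
have h i := cid (proj_split (P3 i) (hP i) (PP i)).
pose r i := projT1 (h i); have h' i := cid (projT2 (h i)).
pose W i : 'M_(_, r i) := projT1 (h' i).
have rW i : overK K (W i) by case: (projT2 (h' i)).
have WW i : (W i)^t* *m W i = 1%:M by case: (projT2 (h' i)).
have WP i : W i *m (W i)^t* = P i by case: (projT2 (h' i)).
have PW i : P i *m W i = W i by rewrite -WP -mulmxA WW mulmx1.
exists (@Rep _ _ _ Q r (fun a => (W (tgt Q a))^t* *m rmat E a *m W (src Q a))), W.
split=> //; first by move=> a; apply: overKM => //; apply: overKM => //; exact: overK_adj.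
split=> // a /=.
  by rewrite !mulmxA WP P1 -mulmxA PW.
by rewrite !adjmxM trmxCK !mulmxA WP P2 -mulmxA PW.
Qed.

Lemma embK_compl K A E : repK K E -> embK K A E ->
  exists2 D, repK K D & isoK K E (dsum A D).
Proof.
move=> rE [V [hV VV]].
have hVV := homK_comp (homK_adj hV) hV.
have [||D [W [rD hW WW WP]]] :=
    homK_proj_split rE (homKD (homK1 K E) (homKN hVV)).
- by move=> i; rewrite adjmxB adjmx1 adjmxM trmxCK.
- move=> i; rewrite mulmxBr mulmx1 mulmxBl mul1mx mulmxA -(mulmxA _ _ (V i)).
  by rewrite VV mulmx1 subrr subr0.
exists D => //; apply/isoK_dsumP; exists V, W; split=> // i.
by rewrite WP addrC subrK.
Qed.

Definition indecK K A :=
  [/\ repK K A, ~ dim0 A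
    & forall B B', repK K B -> repK K B' ->
        isoK K A (dsum B B') -> dim0 B \/ dim0 B'].

Lemma indecomposableE A : indecomposable A <-> indecK false A.
Proof.
split=> [[nA iA]|[_ nA iA]]; first by split=> // B B' _ _ /isometricE/iA.
by split=> // B B' /isometricE/iA; apply.
Qed.

Lemma euclideanE A : euclidean A <-> repK true A.
Proof. by split=> rA a; [move=> _|]; exact: rA. Qed.

Lemma R_indecomposableE A : R_indecomposable A <-> indecK true A.
Proof.
split=> [[rA nA iA]|[rA nA iA]]; split=> //.
- exact/euclideanE.
- by move=> B B' /euclideanE rB /euclideanE rB' /R_isometricE/iA; apply.
- exact/euclideanE.
- by move=> B B' /euclideanE rB /euclideanE rB' /R_isometricE/iA; apply.
Qed.

Lemma dim0_eq0 A : dim0 A -> forall B i (M : 'M[C]_(rdim A i, rdim B i)), M = 0.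
Proof. move=> A0 B i M; apply/matrixP => j.
by exfalso; have := leq_ltn_trans (leq0n _) (ltn_ord j); rewrite A0. Qed.

Lemma indecK_proj K A (P : fam A A) :
  indecK K A -> homK K P -> (forall i, (P i)^t* = P i) ->
  (forall i, P i *m P i = P i) ->
  (forall i, P i = 0) \/ (forall i, P i = 1%:M).
Proof.
move=> [rA nA iA] hP sP PP.
have [D [W [rD hW WW WP]]] := homK_proj_split rA hP sP PP.
have [D' rD' iso] := embK_compl rA (ex_intro _ W (conj hW WW)).
have [V [V' [hV hV' VV VV' VP]]] := (isoK_dsumP K A D D').1 iso.
have [D0|D'0] := iA _ _ rD rD' iso.
  by left=> i; rewrite -WP (_ : (W i)^t* = 0) ?mulmx0//; exact: dim0_eq0.
right=> i; rewrite -WP; apply: mulmx1C_eq (WW i).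
by rewrite -[LHS]addn0 -(D'0 i) -[LHS]/(rdim (dsum D D') i) (isoK_dim iso).
Qed.

(** The converse of [indecK_proj]; by it the representations constructed for (c) are shown to be
    indecomposable. *)
Lemma proj_indecK K A : repK K A -> ~ dim0 A ->
  (forall P : fam A A, homK K P -> (forall i, (P i)^t* = P i) ->
     (forall i, P i *m P i = P i) ->
     (forall i, P i = 0) \/ (forall i, P i = 1%:M)) ->
  indecK K A.
Proof.
move=> rA nA iP; split=> // B B' rB rB' /isoK_dsumP[V [W [hV hW VV WW VW]]].
have zero D (X : fam D A) : (forall i, (X i)^t* *m X i = 1%:M) ->
    (forall i, X i *m (X i)^t* = 0) -> dim0 D.
  move=> XX X0 i; have X0' : X i = 0.
    by rewrite -[X i]mulmx1 -(XX i) mulmxA X0 mul0mx.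
  by have := XX i; rewrite X0' mulmx0 => /(congr1 mxrank); rewrite mxrank0 mxrank1.
have [|i|i|P0|P1] := iP (fun i => V i *m (V i)^t*).
- exact: homK_comp (homK_adj hV) hV.
- by rewrite adjmxM trmxCK.
- by rewrite mulmxA -(mulmxA _ _ (V i)) VV mulmx1.
- by left; exact: zero VV P0.
right; apply: zero WW _ => i; have /eqP := VW i.
by rewrite P1 -subr_eq0 addrAC subrr add0r => /eqP.
Qed.

(** The diagonalisations at the two ends of an arrow are unrelated, but the functional calculus
    respects every intertwiner between Hermitian matrices, in particular each arrow and its
    adjoint. *)
Lemma homK_funcalc K A (H : fam A A) (f : C -> C) :
  homK K H -> (forall i, (H i)^t* = H i) ->
  (forall x, x \is Num.real -> f x \is Num.real) ->
  homK K (fun i => (spectralmx (H i))^t* *m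
    diag_mx (map_mx f (spectral_diag (H i))) *m spectralmx (H i)).
Proof.
move=> [H1 H2 H3] hH rf.
have s i := herm_spectral (hH i).
split=> [a|a|i].
- have [Us Es rs] := s (src Q a); have [Ut Et rt] := s (tgt Q a).
  by apply/esym/(funcalc_intertwine _ Us Ut); rewrite -Es -Et.
- have [Us Es rs] := s (src Q a); have [Ut Et rt] := s (tgt Q a).
  by apply/esym/(funcalc_intertwine _ Ut Us); rewrite -Es -Et.
- by have [Us Es rs] := s i; exact: funcalc_real (H3 i) Us Es rs rf.
Qed.

(** Applied to [H], the indicator [f] of one eigenvalue [c] at one vertex gives a projection
    endomorphism. It is nonzero at that vertex, hence 1 everywhere, and [c] is the only eigenvalue
    at every vertex. *)
Lemma schur_herm K A (H : fam A A) :
  indecK K A -> homK K H -> (forall i, (H i)^t* = H i) ->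
  exists c, forall i, H i = c%:M.
Proof.
move=> iA hH sH; have [rA nA _] := iA.
have [i0 [j0 _]] : exists i, exists j : 'I_(rdim A i), True.
  apply: contrapT => no; apply: nA => i; case E : (rdim A i) => [//|n].
  by case: no; exists i; exists (cast_ord (esym E) ord0).
have s i := herm_spectral (sH i).
pose c := spectral_diag (H i0) 0 j0; pose f x : C := (x == c)%:R.
have rf (x : C) : x \is Num.real -> f x \is Num.real by rewrite /f realn.
have fE n (d : 'rV_n) : map_mx (@Num.conj C) (diag_mx (map_mx f d)) = diag_mx (map_mx f d).
  by apply/matrixP => i j; rewrite !mxE rmorphMn/= /f rmorph_nat.
have ff n (d : 'rV_n) : diag_mx (map_mx f d) *m diag_mx (map_mx f d) = diag_mx (map_mx f d).
  rewrite mulmx_diag; congr diag_mx; apply/matrixP => i j; rewrite !mxE /f ord1.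
  by case: eqP; rewrite ?mulr0 ?mulr1.
have [i|i|P0|P1] := indecK_proj iA (homK_funcalc hH sH rf).
- rewrite !adjmxM trmxCK tr_diag_mx fE mulmxA//.
- have [Us _ _] := s i; rewrite !mulmxA -(mulmxA _ _ ((spectralmx _)^t*)) Us mulmx1.
  by rewrite -(mulmxA _ _ (diag_mx _)) ff.
- have [Us _ _] := s i0.
  have := congr1 (fun M => spectralmx (H i0) *m M *m (spectralmx (H i0))^t*) (P0 i0).
  rewrite !mulmxA Us mul1mx -mulmxA Us mulmx1 mulmx0 mul0mx => /matrixP/(_ j0 j0).
  by rewrite !mxE eqxx /f eqxx => /eqP; rewrite oner_eq0.
- exists c => i; have [Us Es _] := s i.
  have dc : diag_mx (spectral_diag (H i)) = c%:M.
    have := congr1 (fun M => spectralmx (H i) *m M *m (spectralmx (H i))^t*) (P1 i).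
    rewrite !mulmxA Us mul1mx -mulmxA Us mulmx1 mulmx1 Us => /matrixP E.
    apply/matrixP => j k; rewrite !mxE; case: eqP => [jk|]; last by rewrite mulr0n.
    have := E j j; rewrite !mxE eqxx /f; case: eqP => [-> //|_ /eqP].
    by rewrite eq_sym oner_eq0.
  by rewrite Es dc scalar_mxC -mulmxA (mulmx1C Us) mulmx1.
Qed.

Lemma schur_emb K A B (T : fam A B) :
  indecK K A -> homK K T -> (exists i, T i != 0) ->
  exists2 c, 0 < c & forall i, (T i)^t* *m T i = c%:M.
Proof.
move=> iA hT [i0 T0].
have [|c cE] := schur_herm iA (homK_comp hT (homK_adj hT)).
  by move=> i; rewrite adjmxM trmxCK.
exists c => //; have [j Tj] : exists j, col j (T i0) != 0.
  apply/existsP; apply: contraR T0 => /existsPn allz; apply/eqP/matrixP => i j.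
  by have /negbNE/eqP/matrixP/(_ i 0) := allz j; rewrite !mxE.
have [s ss /(_ Tj)] := adj_mulmx_scal (col j (T i0)).
suff -> : s = c by [].
have := congr1 (fun M : 'M_1 => M 0 0) ss; rewrite !mxE eqxx mulr1n => <-.
have /matrixP/(_ j j) := cE i0; rewrite !mxE eqxx mulr1n => <-.
by apply: eq_bigr => k _; rewrite !mxE.
Qed.

Lemma schur_embK K A B (T : fam A B) :
  indecK K A -> homK K T -> (exists i, T i != 0) -> embK K A B.
Proof.
move=> iA hT T0; have [c c0 cE] := schur_emb iA hT T0.
have rs : (sqrtC c)^-1 \is Num.real.
  by rewrite rpredV ger0_real// sqrtC_ge0 ltW.
exists (fun i => (sqrtC c)^-1 *: T i); split; first exact: homKZ.
move=> i; rewrite adjmxZ -scalemxAl -scalemxAr cE scalerA (CrealP rs).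
by rewrite -invfM -expr2 sqrtCK scale_scalar_mx mulVf ?lt0r_neq0.
Qed.

Lemma schur_iso K A B (T : fam A B) :
  indecK K A -> indecK K B -> homK K T -> (exists i, T i != 0) -> isoK K A B.
Proof.
move=> iA iB hT T0.
have T0' : exists i, (T i)^t* != 0 by case: T0 => i Ti; exists i; rewrite adjmx_eq0.
have emb1 := schur_embK iA hT T0.
have emb2 := schur_embK iB (homK_adj hT) T0'.
apply: embK_iso => // i; apply/eqP.
by rewrite eqn_leq (embK_dim i emb1) (embK_dim i emb2).
Qed.

(* Given a unitary block matrix with blocks [a], [b], [c], [d], feeding the
   first output back into the first input gives the unitary [d + c (1-a)^-1 b]. *)
Lemma feedback_isometry k m n (a : 'M[C]_k) (b : 'M_(k, m)) (c : 'M_(n, k))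
    (d : 'M_(n, m)) u :
  a^t* *m a + c^t* *m c = 1%:M -> b^t* *m b + d^t* *m d = 1%:M ->
  a^t* *m b + c^t* *m d = 0 -> a *m u = u - b ->
  (d + c *m u)^t* *m (d + c *m u) = 1%:M.
Proof.
move=> ac bd abcd au.
have cc : c^t* *m c = 1%:M - a^t* *m a by rewrite -ac addrC addKr.
have dd : d^t* *m d = 1%:M - b^t* *m b by rewrite -bd addrC addKr.
have cd : c^t* *m d = - (a^t* *m b) by apply/eqP; rewrite -addr_eq0 addrC abcd.
have dc : d^t* *m c = - (b^t* *m a).
  by rewrite -[LHS]trmxCK adjmxM trmxCK cd adjmxN adjmxM trmxCK.
rewrite adjmxD adjmxM mulmxDl !mulmxDr !mulmxA -(mulmxA _ (c^t*) d) cd.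
rewrite -(mulmxA (u^t*) (c^t*) c) cc dd dc mulmxN mulmxBr mulmx1 mulNmx mulmxBl.
rewrite !mulmxA -!(mulmxA _ a u) au -adjmxM au adjmxB !(mulmxBl, mulmxBr).
by apply/matrixP => i j; rewrite !mxE; ring.
Qed.

Lemma isoK_cancel K B X Y :
  indecK K B -> isoK K (dsum B X) (dsum B Y) -> isoK K X Y.
Proof.
move=> iB [S [hS S1 S2]].
(* If [1 - a] vanishes, then [1 + a = 2] does not: replace [S] by [- S]. *)
wlog [i0 a1] : S hS S1 S2 / exists i,
    1%:M - (dsum_inl B Y i)^t* *m S i *m dsum_inl B X i != 0.
  move=> wl; have [ne|] := EM (exists i,
    1%:M - (dsum_inl B Y i)^t* *m S i *m dsum_inl B X i != 0); first exact: wl ne.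
  move=> all0; apply: (wl (fun i => - S i)); first exact: homKN.
  - by move=> i; rewrite adjmxN mulNmx mulmxN opprK.
  - by move=> i; rewrite adjmxN mulNmx mulmxN opprK.
  have [_ nB _] := iB.
  have [i Bi] : exists i, rdim B i != 0%N.
    by apply: contrapT => no; apply: nB => i; apply/eqP/negPn/negP => ?; apply: no; exists i.
  exists i; rewrite mulmxN mulNmx opprK; apply/negP => /eqP two.
  have : 1%:M - (dsum_inl B Y i)^t* *m S i *m dsum_inl B X i = 0.
    by apply/eqP/negPn/negP => ?; apply: all0; exists i.
  move=> one; have : (1%:M : 'M[C]_(rdim B i)) *+ 2 = 0.
    by move/eqP: one; rewrite mulr2n subr_eq0 => /eqP {2}->.
  move=> /(congr1 (fun M => 2%:R^-1 *: M)); rewrite scaler0 -scaler_nat scalerA.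
  rewrite mulVf ?pnatr_eq0// scale1r => /(congr1 mxrank); rewrite mxrank0 mxrank1.
  by move/eqP; rewrite (negPf Bi).
pose a i := (dsum_inl B Y i)^t* *m S i *m dsum_inl B X i.
pose b i := (dsum_inl B Y i)^t* *m S i *m dsum_inr B X i.
pose c i := (dsum_inr B Y i)^t* *m S i *m dsum_inl B X i.
pose d i := (dsum_inr B Y i)^t* *m S i *m dsum_inr B X i.
have ha : homK K a := homK_comp (homK_inl K B X) (homK_comp hS (homK_adj (homK_inl K B Y))).
have hb : homK K b := homK_comp (homK_inr K B X) (homK_comp hS (homK_adj (homK_inl K B Y))).
have hc : homK K c := homK_comp (homK_inl K B X) (homK_comp hS (homK_adj (homK_inr K B Y))).
have hd : homK K d := homK_comp (homK_inr K B X) (homK_comp hS (homK_adj (homK_inr K B Y))).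
have hN := homKD (homK1 K B) (homKN ha).
have [s s0 sE] := schur_emb iB hN (ex_intro _ i0 a1).
(* As a nonzero endomorphism of an indecomposable, [1 - a] is a multiple of a unitary, and its
   inverse is [s^-1] times its adjoint. So [u], which is [(1 - a)^-1 b], is again a homomorphism
   over the same field. *)
pose u i := s^-1 *: ((1%:M - a i)^t* *m b i).
have au i : a i *m u i = u i - b i.
  have NN : (1%:M - a i) *m (1%:M - a i)^t* = s%:M.
    have /mulmx1C : s^-1 *: (1%:M - a i)^t* *m (1%:M - a i) = 1%:M.
      by rewrite -scalemxAl sE scale_scalar_mx mulVf ?lt0r_neq0.
    rewrite -scalemxAr => /(congr1 (fun M => s *: M)).
    by rewrite scalerA mulfV ?lt0r_neq0// scale1r scalemx1.
  have : (1%:M - a i) *m u i = b i.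
    rewrite /u -scalemxAr mulmxA NN mul_scalar_mx scalerA mulVf ?scale1r//.
    exact: lt0r_neq0.
  by rewrite mulmxBl mul1mx => <-; rewrite opprB addrC subrK.
apply: embK_iso.
  move=> i; have := isoK_dim (ex_intro _ S (And3 hS S1 S2)) i.
  by move/eqP; rewrite /= eqn_add2l => /eqP.
exists (fun i => d i + c i *m u i); split.
  apply: homKD => //; apply: homK_comp => //; apply: homKZ.
    by rewrite rpredV gtr0_real.
  exact: homK_comp hb (homK_adj hN).
move=> i; have [_ _ _ _ sY] := dsum_inE B Y i.
have [ll rr lr rl _] := dsum_inE B X i.
(* The block columns of the isometry [S] inherit its Gram relations, which are what
   [feedback_isometry] asks for. *)
have key k l (M : 'M_(_, k)) (N : 'M_(_, l)) :
    ((dsum_inl B Y i)^t* *m S i *m M)^t* *m ((dsum_inl B Y i)^t* *m S i *m N) +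
    ((dsum_inr B Y i)^t* *m S i *m M)^t* *m ((dsum_inr B Y i)^t* *m S i *m N)
    = M^t* *m N.
  rewrite !adjmxM !trmxCK !mulmxA -!mulmxDl -!mulmxA -!mulmxDr.
  by rewrite sY mulmx1 mulmxA -(mulmxA _ ((S i)^t*)) S1 mulmx1.
by apply: (feedback_isometry (a := a i) (b := b i)) => //; rewrite key.
Qed.

End StarHomomorphisms.

(** * Decompositions into indecomposables *)

Section Decompositions.
Variables (C : numClosedFieldType) (p q : nat) (Q : quiver p q).
Implicit Types (K : bool) (A B D E : rep C Q).

Lemma not_dim0 A : ~ dim0 A -> exists i, rdim A i != 0%N.
Proof.
move=> nA; apply: contrapT => no; apply: nA => i.
by apply/eqP/negPn/negP => ?; apply: no; exists i.
Qed.

Lemma emb_neq0 A B (S : fam A B) :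
  ~ dim0 A -> (forall i, (S i)^t* *m S i = 1%:M) -> exists i, S i != 0.
Proof.
move=> /not_dim0[i Ai] SS; exists i; apply: contra Ai => /eqP S0.
by have := SS i; rewrite S0 mulmx0 => /(congr1 mxrank); rewrite mxrank0 mxrank1 => <-.
Qed.

Lemma isoK_dsum_congr K A A' B B' :
  isoK K A A' -> isoK K B B' -> isoK K (dsum A B) (dsum A' B').
Proof.
move=> [S [hS S1 S2]] [T [hT T1 T2]]; apply/isoK_dsumP.
exists (fun i => dsum_inl A B i *m (S i)^t*), (fun i => dsum_inr A B i *m (T i)^t*).
split=> [||i|i|i].
- exact: homK_comp (homK_adj hS) (homK_inl _ _ _).
- exact: homK_comp (homK_adj hT) (homK_inr _ _ _).
- have [ll _ _ _ _] := dsum_inE A B i.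
  by rewrite adjmxM trmxCK mulmxA -(mulmxA _ _ (dsum_inl A B i)) ll mulmx1.
- have [_ rr _ _ _] := dsum_inE A B i.
  by rewrite adjmxM trmxCK mulmxA -(mulmxA _ _ (dsum_inr A B i)) rr mulmx1.
- have [_ _ _ _ <-] := dsum_inE A B i; rewrite !adjmxM !trmxCK !mulmxA.
  by rewrite -(mulmxA _ _ (S i)) S1 mulmx1 -(mulmxA _ _ (T i)) T1 mulmx1.
Qed.

Lemma isoK_dsum_swap K A B D :
  isoK K (dsum A (dsum B D)) (dsum B (dsum A D)).
Proof.
pose E := dsum A (dsum B D).
have hB := homK_comp (homK_inl K B D) (homK_inr K A (dsum B D)).
have hD := homK_comp (homK_inr K B D) (homK_inr K A (dsum B D)).
apply/isoK_dsumP; exists (fun i => dsum_inr A (dsum B D) i *m dsum_inl B D i).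
exists (fun i => dsum_inl A (dsum B D) i *m (dsum_inl A D i)^t* +
  dsum_inr A (dsum B D) i *m dsum_inr B D i *m (dsum_inr A D i)^t*).
split=> // [|i|i|i].
- apply: homKD.
    exact: homK_comp (homK_adj (homK_inl _ _ _)) (homK_inl _ _ _).
  exact: homK_comp (homK_adj (homK_inr _ _ _)) hD.
- have [_ rr _ _ _] := dsum_inE A (dsum B D) i.
  have [ll _ _ _ _] := dsum_inE B D i.
  by rewrite adjmxM mulmxA -(mulmxA _ _ (dsum_inr A _ i)) rr mulmx1.
- have [ll rr lr rl _] := dsum_inE A (dsum B D) i.
  have [_ rr' _ _ _] := dsum_inE B D i; have [_ _ _ _ <-] := dsum_inE A D i.
  rewrite adjmxD !adjmxM !trmxCK mulmxDl !mulmxDr !mulmxA.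
  rewrite -!(mulmxA _ _ (dsum_inl A (dsum B D) i)).
  rewrite -!(mulmxA _ _ (dsum_inr A (dsum B D) i)) ll rr lr rl.
  rewrite !mulmx1 !mulmx0 !mul0mx -(mulmxA _ _ (dsum_inr B D i)) rr' mulmx1.
  by rewrite addr0 add0r.
- have [_ _ _ _ <-] := dsum_inE A (dsum B D) i.
  have [_ _ _ _ s] := dsum_inE B D i; have [ll rr lr rl _] := dsum_inE A D i.
  rewrite adjmxD !adjmxM !trmxCK mulmxDl !mulmxDr !mulmxA.
  rewrite -!(mulmxA _ _ (dsum_inl A D i)) -!(mulmxA _ _ (dsum_inr A D i)).
  rewrite ll rr lr rl !mulmx1 !mulmx0 !mul0mx addr0 add0r addrCA; congr (_ + _).
  by rewrite -mulmxDl -!(mulmxA (dsum_inr A _ i)) -mulmxDr s mulmx1.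
Qed.

Definition tdim A := (\sum_i rdim A i)%N.

Lemma tdim_eq0 A : tdim A = 0%N <-> dim0 A.
Proof.
split=> [/eqP|A0]; last by rewrite /tdim big1// => i _; exact: A0.
by rewrite sum_nat_eq0 => /forallP A0 i; apply/eqP/A0.
Qed.

Lemma tdim_gt0 A : ~ dim0 A -> (0 < tdim A)%N.
Proof. by move=> nA; rewrite lt0n; apply/eqP => /tdim_eq0. Qed.

Lemma tdim_dsum K E A B : isoK K E (dsum A B) -> tdim E = (tdim A + tdim B)%N.
Proof.
by move=> iso; rewrite /tdim -big_split; apply: eq_bigr => i _; exact: isoK_dim iso i.
Qed.

Lemma exists_indecK_emb K A : repK K A -> ~ dim0 A ->
  exists2 B, indecK K B & embK K B A.
Proof.
have [n] := ubnP (tdim A); elim: n A => // n IH A; rewrite ltnS => An rA nA.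
have [iA|niA] := EM (indecK K A).
  by exists A => //; exact: isoK_emb (isoK_refl _ _).
have [B [B' [rB rB' nB nB' iso]]] : exists B B',
    [/\ repK K B, repK K B', ~ dim0 B, ~ dim0 B' & isoK K A (dsum B B')].
  apply: contrapT => no; apply: niA; split=> // B B' rB rB' iso.
  have [?|nB] := EM (dim0 B); [by left|right].
  by apply: contrapT => nB'; apply: no; exists B, B'.
have [||// |D iD eD] := IH B; last first.
- exists D => //; apply: embK_trans eD _.
  by have /isoK_dsumP[V [_ [hV _ VV _ _]]] := iso; exists V.
- by [].
- apply: leq_trans An; rewrite (tdim_dsum iso) -ltn_subLR ?subnn ?tdim_gt0//.
Qed.

Lemma exists_decomposition K A : repK K A ->
  exists n (B : 'I_n -> rep C Q), (forall k, indecK K (B k)) /\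
    isoK K A (\big[@dsum _ _ _ Q/rep0 _ Q]_(k < n) B k).
Proof.
have [n] := ubnP (tdim A); elim: n A => // n IH A; rewrite ltnS => An rA.
have [A0|nA] := EM (dim0 A).
  exists 0%N, (fun=> A); split; first by case.
  rewrite big_ord0; apply: embK_iso; first exact: A0.
  exists (fun i => 0); split; first by split=> *; rewrite ?mulmx0 ?mul0mx//; exact: overK0.
  by move=> i; rewrite mulmx0; apply/esym/(dim0_eq0 A0 (B := A)).
have [B0 iB0 eB0] := exists_indecK_emb rA nA.
have [D rD iso] := embK_compl rA eB0.
have [|m [B [iB isoD]]] := IH D _ rD.
  have [_ nB0 _] := iB0; apply: leq_trans An.
  by rewrite (tdim_dsum iso) -{1}[tdim D]add0n ltn_add2r tdim_gt0.
exists m.+1, (fun k => if unlift ord0 k is Some j then B j else B0); split.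
  by move=> k; case: unliftP.
rewrite big_ord_recl unlift_none; under eq_bigr do rewrite liftK.
exact: isoK_trans iso (isoK_dsum_congr (isoK_refl _ _) isoD).
Qed.

Local Notation big r F := (\big[@dsum _ _ _ Q/rep0 _ Q]_(i <- r) F i).

Lemma hom_big_component K (I : eqType) (r : seq I) (F : I -> rep C Q) A
    (T : fam A (big r F)) :
  homK K T -> (exists i, T i != 0) ->
  exists2 k, k \in r & exists2 S : fam A (F k), homK K S & exists i, S i != 0.
Proof.
elim: r T => [|k r IH].
  rewrite big_nil => T _ [i /negP[]]; apply/eqP/matrixP => j.
  by have := ltn_ord j.
rewrite big_cons => T hT [i Ti].
have [T0|nz] := EM (exists i, (dsum_inl (F k) (big r F) i)^t* *m T i != 0).
  exists k; first exact: mem_head.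
  exists (fun i => (dsum_inl (F k) (big r F) i)^t* *m T i) => //.
  exact: homK_comp hT (homK_adj (homK_inl _ _ _)).
have [||l lr hl] := IH (fun i => (dsum_inr (F k) (big r F) i)^t* *m T i).
- exact: homK_comp hT (homK_adj (homK_inr _ _ _)).
- exists i; apply: contra Ti => /eqP rT0; have [_ _ _ _ s] := dsum_inE (F k) (big r F) i.
  rewrite -[T i]mul1mx -s mulmxDl -!mulmxA rT0 mulmx0 addr0.
  have [->|lT0] := eqVneq ((dsum_inl (F k) (big r F) i)^t* *m T i) 0; first by rewrite mulmx0.
  by case: nz; exists i.
- by exists l; rewrite // in_cons lr orbT.
Qed.

Lemma isoK_big_rem K (I : eqType) (r : seq I) (F : I -> rep C Q) k : k \in r ->
  isoK K (big r F) (dsum (F k) (big (rem k r) F)).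
Proof.
elim: r => // j r IH; rewrite in_cons /=.
have [-> _|jk /= kr] := eqVneq k j; first by rewrite big_cons; exact: isoK_refl.
rewrite !big_cons; apply: isoK_trans (isoK_dsum_swap _ _ _ _).
exact: isoK_dsum_congr (isoK_refl _ _) (IH kr).
Qed.

(** The first summand of [r] maps nontrivially to some summand of the other side, is isometric to it
    by Schur, and both are cancelled. Sequences allow the partner to be removed by [rem]. *)
Lemma isoK_big_match K (I J : eqType) (r : seq I) (r' : seq J)
    (F : I -> rep C Q) (G : J -> rep C Q) :
  (forall i, indecK K (F i)) -> (forall j, indecK K (G j)) ->
  isoK K (big r F) (big r' G) ->
  exists s : seq J, [/\ perm_eq s r', size s = size r
    & forall i j, (i, j) \in zip r s -> isoK K (F i) (G j)].
Proof.
move=> iF iG; elim: r r' => [|i r IH] r' iso.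
  case: r' iso => [|j r' iso]; first by exists [::].
  have [_ nG _] := iG j; case: nG => l; have := isoK_dim iso l.
  by rewrite big_nil big_cons /= => /esym/eqP; rewrite addn_eq0 => /andP[/eqP].
move: iso; rewrite big_cons => iso; have [S [hS S1 _]] := iso.
have [_ nF _] := iF i.
have [k kr' [T hT T0]] : exists2 k, k \in r' &
    exists2 T : fam (F i) (G k), homK K T & exists i, T i != 0.
  apply: hom_big_component (homK_comp (homK_inl K _ _) hS) _.
  apply: emb_neq0 => // l; have [ll _ _ _ _] := dsum_inE (F i) (big r F) l.
  by rewrite adjmxM mulmxA -(mulmxA _ _ (S l)) S1 mulmx1.
have FG : isoK K (F i) (G k) := schur_iso (iF i) (iG k) hT T0.
have iso2 : isoK K (dsum (F i) (big r F)) (dsum (F i) (big (rem k r') G)).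
  apply: isoK_trans iso (isoK_trans (isoK_big_rem _ _ kr') _).
  exact: isoK_dsum_congr (isoK_sym FG) (isoK_refl _ _).
have [s [ps ss zs]] := IH _ (isoK_cancel (iF i) iso2).
exists (k :: s); split; last 2 first.
- by rewrite /= ss.
- by move=> i' j'; rewrite /= in_cons => /orP[/eqP[-> ->]|/zs].
by rewrite perm_sym (permPl (perm_to_rem kr')) perm_cons perm_sym.
Qed.

Lemma isoK_unique K m n (F : 'I_m -> rep C Q) (G : 'I_n -> rep C Q) :
  (forall i, indecK K (F i)) -> (forall j, indecK K (G j)) ->
  isoK K (\big[@dsum _ _ _ Q/rep0 _ Q]_(k < m) F k)
         (\big[@dsum _ _ _ Q/rep0 _ Q]_(k < n) G k) ->
  exists s : 'I_m -> 'I_n, bijective s /\ forall k, isoK K (F k) (G (s k)).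
Proof.
have enumE k : index_enum 'I_k = enum 'I_k.
  by rewrite enumT [index_enum _]unlock.
move=> iF iG; rewrite !enumE => /(isoK_big_match iF iG)[s [ps ss zs]].
have sm : size s == m by rewrite ss size_enum_ord.
have mn : m = n by rewrite -(eqP sm) (perm_size ps) size_enum_ord.
exists (tnth (Tuple sm)); split.
  apply: inj_card_bij; last by rewrite !card_ord mn.
  by apply/tuple_uniqP; rewrite /= (perm_uniq ps) enum_uniq.
move=> k; apply: zs; rewrite (tnth_nth (tnth (Tuple sm) k)) /=.
have -> : (k, nth (tnth (Tuple sm) k) s k) =
    nth (k, tnth (Tuple sm) k) (zip (enum 'I_m) s) k.
  by rewrite nth_zip ?ss// nth_ord_enum.
by rewrite mem_nth// size_zip ss minnn size_enum_ord.
Qed.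

(** The isometric factor [T (T^* T)^(-1/2)] of the polar decomposition. The absolute value in [f]
    makes it real on all reals, as [homK_funcalc] requires; the eigenvalues are positive because [T]
    is injective. *)
Lemma injective_embK K A B (T : fam A B) : homK K T ->
  (forall i (x : 'cV_(rdim A i)), T i *m x = 0 -> x = 0) -> embK K A B.
Proof.
move=> hT injT; pose f (x : C) := (sqrtC `|x|)^-1.
have rf (x : C) : x \is Num.real -> f x \is Num.real.
  by move=> _; rewrite rpredV ger0_real// sqrtC_ge0.
have sH i : ((T i)^t* *m T i)^t* = (T i)^t* *m T i by rewrite adjmxM trmxCK.
have hH := homK_comp hT (homK_adj hT).
have hP := homK_funcalc hH sH rf.
exists (fun i => T i *m ((spectralmx ((T i)^t* *m T i))^t* *m
    diag_mx (map_mx f (spectral_diag ((T i)^t* *m T i))) *m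
    spectralmx ((T i)^t* *m T i))); split; first exact: homK_comp hP hT.
move=> i; have [] := herm_spectral (sH i).
move: (spectralmx _) (spectral_diag _) => U d UU HE rd.
have d0 k : 0 < d 0 k.
  have v0 : col k (T i *m U^t*) != 0.
    apply/eqP; rewrite colE -mulmxA => /injT/(congr1 (fun M => U *m M)).
    rewrite mulmxA UU mul1mx mulmx0 => /matrixP/(_ k 0); rewrite !mxE !eqxx.
    by move/eqP; rewrite oner_eq0.
  have [s ss /(_ v0)] := adj_mulmx_scal (col k (T i *m U^t*)).
  suff -> : s = d 0 k by [].
  have DE : (T i *m U^t*)^t* *m (T i *m U^t*) = diag_mx d.
    rewrite adjmxM trmxCK mulmxA -(mulmxA _ _ (T i)) HE !mulmxA UU mul1mx.
    by rewrite -mulmxA UU mulmx1.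
  have /matrixP/(_ k k) := DE; rewrite [RHS]mxE eqxx mulr1n => <-.
  have /matrixP/(_ 0 0) := ss; rewrite [RHS]mxE eqxx mulr1n => <-.
  by rewrite !mxE; apply: eq_bigr => j _; rewrite !mxE.
have fd : (diag_mx (map_mx f d))^t* = diag_mx (map_mx f d).
  apply/matrixP => k l; rewrite !mxE rmorphMn/= eq_sym.
  have -> : (f (d 0 l))^* = f (d 0 l) by apply/CrealP/rf/gtr0_real.
  by case: eqP => [->|//].
rewrite !adjmxM trmxCK fd !mulmxA -(mulmxA _ _ (T i)) HE !mulmxA.
rewrite -(mulmxA _ U (U^t*)) UU mulmx1 -(mulmxA _ U (U^t*)) UU mulmx1.
rewrite -!(mulmxA (U^t*)).
rewrite !mulmx_diag (_ : diag_mx _ = 1%:M) ?mul1mx ?(mulmx1C UU)//.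
apply/matrixP => k l; rewrite !mxE; congr (_ *+ _).
rewrite /f gtr0_norm// mulrAC -invfM -expr2 sqrtCK mulVf//.
exact: lt0r_neq0.
Qed.

Lemma homK_ReIm A B (S : fam A B) : repK true A -> repK true B -> homK false S ->
  homK true (fun i => map_mx (@Re C) (S i)) /\
  homK true (fun i => map_mx (@Im C) (S i)).
Proof.
move=> rA rB [S1 S2 _].
have rR m n (M : 'M[C]_(m, n)) : map_mx (@Re C) M \is a realmx.
  by apply/mxOverP => i j; rewrite mxE Creal_Re.
have rI m n (M : 'M[C]_(m, n)) : map_mx (@Im C) M \is a realmx.
  by apply/mxOverP => i j; rewrite mxE Creal_Im.
have crect m n (M : 'M[C]_(m, n)) : M = map_mx (@Re C) M + 'i *: map_mx (@Im C) M.
  by apply/matrixP => i j; rewrite !mxE -Crect.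
have split2 m n m' n' (M : 'M[C]_(m, n)) (N : 'M_(m', n')) (a : 'M_(n, n')) b :
    a \is a realmx -> b \is a realmx -> M *m a = b *m N ->
    map_mx (@Re C) M *m a = b *m map_mx (@Re C) N /\
    map_mx (@Im C) M *m a = b *m map_mx (@Im C) N.
  move=> ra rb; have rM k l t (x : 'M[C]_(k, l)) (y : 'M_(l, t)) :
      x \is a realmx -> y \is a realmx -> x *m y \is a realmx.
    by move=> rx ry; apply: (overKM (K := true)).
  rewrite {1}(crect _ _ M) {1}(crect _ _ N) mulmxDl mulmxDr -scalemxAl -scalemxAr.
  move/(eqmx_ReiIm (rM _ _ _ _ _ (rR _ _ _) ra) (rM _ _ _ _ _ (rI _ _ _) ra)
    (rM _ _ _ _ _ rb (rR _ _ _)) (rM _ _ _ _ _ rb (rI _ _ _))).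
  by case.
have rT A' a : repK true A' -> rmat A' a \is a realmx by move=> /(_ a); apply.
have rT' A' a : repK true A' -> (rmat A' a)^t* \is a realmx.
  by move=> /rT r; apply: (overK_adj (K := true)).
by split; split=> [a|a|i _] //;
  have [] := split2 _ _ _ _ _ _ _ _ (rT _ a rA) (rT _ a rB) (S1 a);
  have [] := split2 _ _ _ _ _ _ _ _ (rT' _ a rA) (rT' _ a rB) (S2 a).
Qed.

Lemma poly_nat_nonroot (P : {poly C}) : P != 0 -> exists n, P.[n%:R] != 0.
Proof.
move=> P0; apply: contrapT => no.
have := max_poly_roots (rs := [seq n%:R | n <- iota 0 (size P)]) P0.
rewrite size_map size_iota ltnn => /(_ _ _)/negP; apply=> //.
  apply/allP => _ /mapP[n _ ->]; apply/negPn/negP => Pn; apply: no.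
  by exists n.
by rewrite map_inj_uniq ?iota_uniq//; exact: mulrIn (oner_neq0 _).
Qed.

Lemma isoK_true_false A B : repK true A -> repK true B ->
  isoK false A B -> isoK true A B.
Proof.
move=> rA rB iso; have [S [hS S1 S2]] := iso.
have [hX hY] := homK_ReIm rA rB hS.
pose X i := map_mx (@Re C) (S i); pose Y i := map_mx (@Im C) (S i).
(* [P i] does not vanish at ['i], hence not at some natural number [n]; the
   isometric part of the real homomorphism [X + n Y] is as required. *)
pose P i : {poly C} := \det (map_mx polyC ((S i)^t* *m X i) +
  'X *: map_mx polyC ((S i)^t* *m Y i)).
(* The factor [(S i)^t*] makes the matrix square although the dimensions of [A] and [B] are only
   provably equal; at ['i] the determinant is that of [(S i)^t* *m S i], which is 1. *)
have PE i t : (P i).[t] = \det ((S i)^t* *m (X i + t *: Y i)).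
  rewrite /P -horner_evalE -det_map_mx; congr (\det _).
  rewrite mulmxDr -scalemxAr; apply/matrixP => k l.
  move: (_ *m X i) (_ *m Y i) => M N.
  by rewrite !mxE /= /horner_eval !hornerE.
have P0 i : P i != 0.
  apply/eqP => /(congr1 (fun r : {poly C} => r.['i])); rewrite PE horner0.
  have -> : X i + 'i *: Y i = S i.
    by apply/matrixP => k l; rewrite !mxE -Crect.
  by rewrite S1 det1 => /eqP; rewrite oner_eq0.
(* One [n] has to serve all vertices, hence the product. *)
have /poly_nat_nonroot[n] : \prod_i P i != 0 by apply/prodf_neq0.
rewrite horner_prod => /prodf_neq0 Pn.
apply: embK_iso; first exact: isoK_dim iso.
apply: (injective_embK (T := fun i => X i + n%:R *: Y i)).
  have rn : n%:R \is @Num.real C by exact: realn.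
  exact: (homKD hX (homKZ rn hY)).
move=> i x Tx; have U : (S i)^t* *m (X i + n%:R *: Y i) \in unitmx.
  by rewrite unitmxE unitfE -PE; exact: Pn.
by rewrite -[x](mulKmx U) -(mulmxA _ _ x) Tx !mulmx0.
Qed.

End Decompositions.

(** * Realification *)

Section Realification.
Variables (C : numClosedFieldType) (p q : nat) (Q : quiver p q).
Implicit Types (K : bool) (A B D E : rep C Q).

Lemma double_add_lt n (l : 'I_n) (b : bool) : (b + l.*2 < n.*2)%N.
Proof. by rewrite -ltn_half_double half_bit_double. Qed.

Definition dbl_ord n (x : 'I_n * bool) : 'I_n.*2 := Ordinal (double_add_lt x.1 x.2).

Lemma half_dbl n (x : 'I_n * bool) : half_ord (dbl_ord x) = x.1.
Proof. by apply/val_inj; rewrite /= half_bit_double. Qed.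

Lemma odd_dbl n (x : 'I_n * bool) : odd (dbl_ord x) = x.2.
Proof. by rewrite /= oddD odd_double addbF oddb. Qed.

Lemma sum_double n (F : 'I_n.*2 -> C) :
  \sum_k F k = \sum_l (F (dbl_ord (l, false)) + F (dbl_ord (l, true))).
Proof.
rewrite (reindex (@dbl_ord n)) /=; last first.
  exists (fun k => (half_ord k, odd k)) => [x _|k _].
    by rewrite half_dbl odd_dbl -surjective_pairing.
  by apply/val_inj; rewrite /= odd_double_half.
rewrite -(pair_big xpredT xpredT (fun l b => F (dbl_ord (l, b)))) /=.
by apply: eq_bigr => l _; rewrite big_bool addrC.
Qed.

(* The columns [(1, 'i)] of [cplx_mx] are eigenvectors of the blocks
   [[a, b], [-b, a]] for the eigenvalue [a + bi]. *)
Definition cplx_mx n : 'M[C]_(n.*2, n) :=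
  \matrix_(r, c) ((if odd r then 'i else 1) *+ (half_ord r == c)).

Lemma realify_mxE m n (M : 'M[C]_(m, n)) r c :
  realify_mx M r c =
    if odd r == odd c then 'Re (M (half_ord r) (half_ord c))
    else if odd r then - 'Im (M (half_ord r) (half_ord c))
    else 'Im (M (half_ord r) (half_ord c)).
Proof. by rewrite mxE. Qed.

Lemma realify_mx_cplx m n (M : 'M[C]_(m, n)) :
  realify_mx M *m cplx_mx n = cplx_mx m *m M.
Proof.
apply/matrixP => r c; rewrite !mxE sum_double (bigD1 c) //= big1 ?addr0 => [|l lc].
  rewrite !realify_mxE !mxE !half_dbl !odd_dbl /= !eqxx !mulr1n mulr1.
  rewrite (bigD1 (half_ord r)) //= big1 ?addr0 => [|l /negPf lr].
    rewrite mxE eqxx mulr1n; set z := M _ c; have zE := Crect z.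
    case: (odd r) => /=; last by rewrite mul1r [_ * 'i]mulrC -zE.
    by rewrite [in RHS]zE mulrDr mulrA -expr2 sqrCi mulN1r addrC [_ * 'i]mulrC.
  by rewrite mxE eq_sym lr mulr0n mul0r.
by rewrite !mxE !half_dbl (negPf lc) !mulr0n !mulr0 addr0.
Qed.

Lemma realify_mx_adj m n (M : 'M[C]_(m, n)) : realify_mx (M^t*) = (realify_mx M)^t*.
Proof.
apply/matrixP => r c; rewrite realify_mxE 4!mxE realify_mxE.
have cR (z : C) : ('Re z)^* = 'Re z by apply/CrealP/Creal_Re.
have cI (z : C) : ('Im z)^* = 'Im z by apply/CrealP/Creal_Im.
rewrite Re_conj Im_conj opprK.
by case: (odd r); case: (odd c); rewrite /= ?rmorphN /= ?cR ?cI.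
Qed.

Lemma cplx_adj n : (cplx_mx n)^t* *m cplx_mx n = 2%:R%:M.
Proof.
apply/matrixP => r c; rewrite !mxE sum_double (bigD1 r) //= big1 ?addr0 => [|l lc].
  rewrite !mxE !half_dbl !odd_dbl /= !eqxx !mulr1n conjC1 conjCi mul1r.
  by case: (r == c); rewrite ?mulr0n ?mulr0 ?addr0// !mulr1n mulNr -expr2 sqrCi opprK.
by rewrite !mxE !half_dbl (negPf lc) !mulr0n conjC0 !mul0r addr0.
Qed.

Lemma cplx_tr n : (cplx_mx n)^T *m cplx_mx n = 0.
Proof.
apply/matrixP => r c; rewrite !mxE sum_double big1 // => l _.
rewrite !mxE !half_dbl !odd_dbl /=.
case: (l == r); case: (l == c); rewrite ?mulr0n ?mulr1n ?mul0r ?mulr0 ?addr0 //.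
by rewrite mul1r -expr2 sqrCi subrr.
Qed.

(** With [cplx_adj] and [cplx_tr]: the columns of [cplx_mx] and of its conjugate form an orthogonal
    basis of vectors of squared length 2. This is the splitting of A^R into A and its conjugate. *)
Lemma cplx_sum n : cplx_mx n *m (cplx_mx n)^t* +
  map_mx (@Num.conj C) (cplx_mx n) *m (map_mx (@Num.conj C) (cplx_mx n))^t* = 2%:R%:M.
Proof.
apply/matrixP => r c; rewrite !mxE -big_split /= (bigD1 (half_ord r)) //=.
rewrite big1 ?addr0 => [|l /negPf lr]; last first.
  by rewrite !mxE eq_sym lr !mulr0n conjC0 !mul0r addr0.
rewrite !mxE eqxx !mulr1n.
have rcE : (r == c) = (odd r == odd c) && (half_ord c == half_ord r).
  apply/eqP/andP => [->|[/eqP o /eqP h]]; first by rewrite !eqxx.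
  apply/val_inj; rewrite /= -(odd_double_half r) -(odd_double_half c) o.
  by have := congr1 val h; rewrite /= => ->.
rewrite rcE; case: (half_ord c == half_ord r); last first.
  by rewrite andbF !mulr0n !conjC0 !mulr0 addr0.
by case: (odd r); case: (odd c);
  rewrite /= ?mulr1n ?mulr0n ?conjCK ?conjC1 ?conjCi ?mulr1 ?mul1r
    ?subrr ?addNr// ?mulrN ?mulNr -?expr2 ?sqrCi ?opprK.
Qed.

Lemma repK_realify A : repK true (realify A).
Proof.
move=> a _; apply/mxOverP => r c; rewrite realify_mxE.
case: ifP => _; first exact: Creal_Re.
by case: ifP => _; rewrite ?realN; exact: Creal_Im.
Qed.

Lemma hom_cplx A : homK false (fun i => cplx_mx (rdim A i) : 'M_(rdim (realify A) i, rdim A i)).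
Proof.
split=> // a /=; first by rewrite realify_mx_cplx.
by rewrite -realify_mx_adj realify_mx_cplx.
Qed.

Lemma homK_conj A B (S : fam A B) : homK false S ->
  homK false (fun i => map_mx (@Num.conj C) (S i) :
    'M_(rdim (rep_conj B) i, rdim (rep_conj A) i)).
Proof.
move=> [S1 S2 _]; split=> // a /=; first by rewrite -!map_mxM S1.
by rewrite !map_trmx -!map_mxM S2.
Qed.

Lemma rmat_conj_real A a : repK true A -> rmat (rep_conj A) a = rmat A a.
Proof. by move=> rA; apply/realmxP/rA. Qed.

Lemma homK_conj_real A B (S : fam A B) : repK true B -> homK false S ->
  homK false (fun i => map_mx (@Num.conj C) (S i) :
    'M_(rdim B i, rdim (rep_conj A) i)).
Proof.
move=> rB /homK_conj[S1 S2 _]; split=> // a.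
  by rewrite S1 rmat_conj_real.
by rewrite S2 rmat_conj_real.
Qed.

Lemma embK_conj_real A E : repK true E -> embK false A E -> embK false (rep_conj A) E.
Proof.
move=> rE [S [hS S1]]; exists (fun i => map_mx (@Num.conj C) (S i)).
split; first exact: homK_conj_real.
by move=> i; rewrite map_trmx -map_mxM S1 map_mx1.
Qed.

Lemma isoK_conj A B : isoK false A B -> isoK false (rep_conj A) (rep_conj B).
Proof.
move=> [S [hS S1 S2]]; exists (fun i => map_mx (@Num.conj C) (S i)).
split; first exact: homK_conj.
  by move=> i; rewrite map_trmx -map_mxM S1 map_mx1.
by move=> i; rewrite map_trmx -map_mxM S2 map_mx1.
Qed.

Lemma isoK_conj_dsum A B :
  isoK false (rep_conj (dsum A B)) (dsum (rep_conj A) (rep_conj B)).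
Proof.
apply: embK_iso => //; exists (fun i => 1%:M); split; last first.
  by move=> i; rewrite mulmx1 adjmx1.
by split=> // a /=; rewrite mul1mx mulmx1 map_block_mx !map_mx0.
Qed.

Lemma isoK_conjK A : isoK false (rep_conj (rep_conj A)) A.
Proof.
apply: embK_iso => //; exists (fun i => 1%:M); split; last first.
  by move=> i; rewrite mulmx1 adjmx1.
split=> // a /=; rewrite mul1mx mulmx1; apply/matrixP => i j;
  by rewrite !mxE !conjCK.
Qed.

Lemma indecK_conj A : indecK false A -> indecK false (rep_conj A).
Proof.
move=> [_ nA iA]; split=> // B B' _ _ iso; apply: (iA (rep_conj B) (rep_conj B')) => //.
apply: isoK_trans (isoK_sym (isoK_conjK A)) _.
exact: isoK_trans (isoK_conj iso) (isoK_conj_dsum _ _).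
Qed.

Lemma isoK_conj_real A B : repK true B -> isoK false A B -> isoK false (rep_conj A) B.
Proof.
move=> rB iso; apply: embK_iso; first exact: isoK_dim iso.
exact: embK_conj_real rB (isoK_emb iso).
Qed.

Lemma scale2_eq0 m n (M : 'M[C]_(m, n)) : 2%:R%:M *m M = 0 -> M = 0.
Proof.
by rewrite mul_scalar_mx => /eqP; rewrite scalemx_eq0 pnatr_eq0 => /eqP.
Qed.

Definition not_real A := forall B, repK true B -> ~ isoK false A B.

Lemma indecK_true A : indecK false A -> repK true A -> indecK true A.
Proof.
move=> [_ nA iA] rA; split=> // B B' rB rB' iso.
by apply: iA => //; exact: isoK_false iso.
Qed.

(** A nonzero Euclidean summand [D], embedded by [W], contains a copy of [A]: as [W] is real, if its
    adjoint killed [cplx_mx] it would also kill the conjugate, and [W] would vanish. Two nonzero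
    summands then both have exactly the dimension of [A], so [A] is isometric to a Euclidean
    representation. *)
Lemma realify_indecK A : indecK false A -> not_real A -> indecK true (realify A).
Proof.
move=> iA nrA; have [_ nA _] := iA; split; first exact: repK_realify.
  by move=> A0; apply: nA => i; apply/eqP; rewrite -double_eq0; apply/eqP/A0.
move=> B B' rB rB' iso; have /isoK_dsumP[V [V' [hV hV' VV VV' VP]]] := iso.
have zero D (W : fam D (realify A)) : homK true W ->
    (forall i, (W i)^t* *m W i = 1%:M) ->
    ~ dim0 D -> embK false A D.
  move=> hW WW nD; have [i Wi] := emb_neq0 nD WW.
  apply: (schur_embK iA (homK_comp (hom_cplx A) (homK_adj (homK_false hW)))).
  exists i; apply: contra Wi => /eqP WJ0; rewrite -adjmx_eq0; apply/eqP.
  have WJ0' : (W i)^t* *m map_mx (@Num.conj C) (cplx_mx (rdim A i)) = 0.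
    have := congr1 (map_mx (@Num.conj C)) WJ0; rewrite map_mxM map_mx0.
    have [_ _ rW] := hW; by rewrite (realmxP _ (overK_adj (rW i) isT)).
  have := cplx_sum (rdim A i) => /(congr1 (mulmx ((W i)^t*))).
  rewrite mulmxDr !mulmxA WJ0 WJ0' !mul0mx addr0 scalar_mxC => /esym.
  exact: scale2_eq0.
apply: contrapT => /not_orP[nB nB'].
have eB := zero _ _ hV VV nB; have eB' := zero _ _ hV' VV' nB'.
apply: (nrA B rB); apply: (embK_iso _ eB) => i; apply/eqP.
have := isoK_dim iso i; rewrite /= -addnn => dims.
have := embK_dim i eB; have := embK_dim i eB'; lia.
Qed.

(** Let J be [cplx_mx] and R the real part of V J^*. From J^* J = 2 and J^T J = 0 it follows that R
    J = V, so the real homomorphism R is nonzero. *)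
Lemma realify_iso A E : indecK false A -> not_real A -> indecK true E ->
  embK false A E -> isoK true (realify A) E.
Proof.
move=> iA nrA iE [V [hV VV]]; have [rE _ _] := iE; have [_ nA _] := iA.
have hX := homK_comp (homK_adj (hom_cplx A)) hV.
have [hR _] := homK_ReIm (@repK_realify A) rE hX.
apply: schur_iso (realify_indecK iA nrA) iE hR _.
have [i Vi] := emb_neq0 nA VV; exists i; apply: contra Vi => /eqP R0.
have X0 : V i *m (cplx_mx _)^t* +
    map_mx (@Num.conj C) (V i *m (cplx_mx (rdim A i))^t*) = 0.
  apply/matrixP => k l; have /matrixP/(_ k l) := R0.
  move: (V i *m _) => M; rewrite !mxE ReE => /eqP.
  by rewrite mulf_eq0 invr_eq0 pnatr_eq0 orbF => /eqP.
have := congr1 (mulmx^~ (cplx_mx (rdim A i))) X0.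
rewrite mulmxDl map_mxM -!mulmxA cplx_adj mul0mx.
have -> : map_mx (@Num.conj C) ((cplx_mx (rdim A i))^t*) = (cplx_mx (rdim A i))^T.
  by apply/matrixP => k l; rewrite !mxE conjCK.
rewrite cplx_tr mulmx0 addr0 scalar_mxC => /scale2_eq0 ->.
exact: eqxx.
Qed.

Lemma real_embK_iso A E : indecK false A -> repK true A -> indecK true E ->
  embK false A E -> isoK true A E.
Proof.
move=> iA rA iE [V [hV VV]]; have [rE _ _] := iE; have [_ nA _] := iA.
have [hR hI] := homK_ReIm rA rE hV; have iA' := indecK_true iA rA.
have [i Vi] := emb_neq0 nA VV.
have [R0|R0] := eqVneq (map_mx (@Re C) (V i)) 0; last first.
  by apply: schur_iso iA' iE hR _; exists i.
apply: schur_iso iA' iE hI _; exists i; apply: contra Vi => /eqP I0.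
apply/eqP/matrixP => k l; rewrite [V i k l]Crect mxE.
have /matrixP/(_ k l) := R0; rewrite !mxE => ->.
by have /matrixP/(_ k l) := I0; rewrite !mxE => ->; rewrite mulr0 addr0.
Qed.

Lemma cplx_fam_neq0 A : ~ dim0 A -> exists i, cplx_mx (rdim A i) != 0.
Proof.
move=> /not_dim0[i Ai]; exists i; apply: contra Ai => /eqP c0.
have := cplx_adj (rdim A i); rewrite c0 mulmx0 => /esym/eqP.
rewrite -scalemx1 scalemx_eq0 pnatr_eq0 /= => /eqP/(congr1 mxrank).
by rewrite mxrank0 mxrank1 => ->.
Qed.

Lemma embK_realify A : indecK false A -> embK false A (realify A).
Proof.
move=> iA; have [_ nA _] := iA.
exact: schur_embK iA (hom_cplx A) (cplx_fam_neq0 nA).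
Qed.

(** [A] embeds in B^R; by [cplx_sum] one of its components along B and along the conjugate of B is
    nonzero. *)
Lemma realify_inj A B : indecK false A -> isoK true (realify A) (realify B) ->
  isoK false A B \/ isoK false A (rep_conj B).
Proof.
move=> iA iso; have dAB : rdim A =1 rdim B.
  by move=> i; apply: double_inj; exact: isoK_dim iso i.
have [T [hT TT]] := embK_trans (embK_realify iA) (isoK_emb (isoK_false iso)).
have [_ nA _] := iA; have [i Ti] := emb_neq0 nA TT.
have hJ := homK_adj (hom_cplx B).
have hJ' := homK_adj (homK_conj_real (@repK_realify B) (hom_cplx B)).
have [J0|J0] := eqVneq ((cplx_mx (rdim B i))^t* *m T i) 0; last first.
  by left; apply: (embK_iso dAB); apply: schur_embK iA (homK_comp hT hJ) _; exists i.
right; apply: (embK_iso (B := rep_conj B) dAB).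
apply: (schur_embK iA (homK_comp hT hJ')); exists i.
apply: contra Ti => /eqP J0'; apply/eqP/scale2_eq0.
by rewrite -cplx_sum mulmxDl -!mulmxA J0 J0' !mulmx0 addr0.
Qed.

Lemma not_realify_real A B : indecK false A -> repK true A -> indecK false B ->
  not_real B -> ~ isoK true A (realify B).
Proof.
move=> iA rA iB nrB iso; apply: (nrB A rA).
have [V [hV VV]] :=
  embK_trans (embK_realify iB) (isoK_emb (isoK_false (isoK_sym iso))).
by have [_ nB _] := iB; exact: schur_iso iB iA hV (emb_neq0 nB VV).
Qed.

End Realification.

(** * Representatives of the R-indecomposables *)

Section CompleteSystem.
Variables (C : numClosedFieldType) (p q : nat) (Q : quiver p q).
Local Open Scope classical_set_scope.
Variables I I1 : set (rep C Q).
Hypotheses (indI : is_ind I) (ind1I : is_ind1 I I1).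

Let I_indec A : I A -> indecK false A.
Proof. by case: indI => -[PI _ _] _ /PI/indecomposableE. Qed.

Let I_surj A : indecK false A -> exists2 B, I B & isoK false A B.
Proof.
case: indI => -[_ sI _] _ /indecomposableE/sI[B IB iAB].
by exists B => //; exact/isometricE.
Qed.

Let I_inj A B : I A -> I B -> isoK false A B -> A = B.
Proof. by case: indI => -[_ _ jI] _ IA IB /isometricE; exact: jI. Qed.

Let I_real A : I A -> repK true A \/ not_real A.
Proof.
move=> IA; have [[B rB iAB]|no] := EM (exists2 B, repK true B & isoK false A B).
  left; apply/euclideanE; case: indI => _; apply=> //.
  by exists B; [exact/euclideanE|exact/isometricE].
by right => B rB iAB; apply: no; exists B.
Qed.

(** In the case of a conjugate pair, an isometry from [A] to a Euclidean representation would make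
    [A] isometric to its own conjugate. *)
Let I1_mem A : I1 A -> I A /\ not_real A.
Proof.
case: ind1I => P [PI _ ->] [[IA _ nrA]|/PI[B [IA IB nAA _]]]; split=> // B' rB' iA.
  apply: nrA; exists B'; last exact/isometricE.
  by move=> a; rewrite (rmat_conj_real a rB').
apply/nAA/isometricE; apply: (isoK_trans iA); apply: isoK_sym.
exact: isoK_conj_real rB' iA.
Qed.

Let I1_surj A : I A -> not_real A ->
  I1 A \/ exists2 B, I1 B & isoK false B (rep_conj A).
Proof.
move=> IA nrA; case: ind1I => P [PI dP ->].
have [iAA|nAA] := EM (isometric A (rep_conj A)).
  left; left; split=> // -[B sB /isometricE]; apply: nrA => a _.
  by apply/realmxP; rewrite [RHS]sB.
have [B IB AB] := I_surj (indecK_conj (I_indec IA)).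
have pAB : conj_pair I A B by split=> //; exact/isometricE.
have [PA|nPA] := EM (P A); first by left; right.
right; exists B; last exact: isoK_sym.
right; apply: contrapT => nPB; apply: nPA; exact/(dP _ _ pAB).
Qed.

(** By [realify_inj], [A] is isometric to [B] or to its conjugate. In the second case, if either is
    isometric to its own conjugate, then [A] and [B] are isometric; otherwise they are the two
    members of one pair, of which only one was chosen. *)
Let I1_inj A B : I1 A -> I1 B -> isoK true (realify A) (realify B) -> A = B.
Proof.
move=> I1A I1B /realify_inj; have [IA nrA] := I1_mem I1A.
have [IB nrB] := I1_mem I1B; move=> /(_ (I_indec IA)) [|AB]; first exact: I_inj.
have BA : isoK false B (rep_conj A).
  exact: isoK_trans (isoK_sym (isoK_conjK B)) (isoK_conj (isoK_sym AB)).
case: ind1I I1A I1B => P [PI dP ->] [[_ /isometricE AA _]|PA] [].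
- by move=> _; apply: I_inj => //; exact: isoK_trans AA (isoK_sym BA).
- by move=> _; apply: I_inj => //; exact: isoK_trans AA (isoK_sym BA).
- move=> [_ /isometricE BB _]; apply: I_inj => //.
  exact: isoK_trans AB (isoK_sym BB).
move=> PB; have [B' [_ IB' nBB BB']] := PI _ PB.
have AB' : A = B'.
  by apply: I_inj => //; apply: isoK_trans AB _; exact/isometricE.
have [PBn _] : P B <-> ~ P A by apply: dP; rewrite AB'; split.
by case: (PBn PB PA).
Qed.

Lemma ind_R_complete : is_ind_R (ind0 I `|` [set realify A | A in I1]).
Proof.
split=> [A [[IA /euclideanE rA]|[B I1B <-]]|E /R_indecomposableE iE|A B].
- exact/R_indecomposableE/(indecK_true (I_indec IA) rA).
- have [IB nrB] := I1_mem I1B.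
  exact/R_indecomposableE/(realify_indecK (I_indec IB) nrB).
- have [rE nE _] := iE.
  have [A0 iA0 eA0] := exists_indecK_emb (fun a (k : false) => rE a isT) nE.
  have [A IA A0A] := I_surj iA0.
  have eA := embK_trans (isoK_emb (isoK_sym A0A)) eA0.
  have iA := I_indec IA.
  have [rA|nrA] := I_real IA.
    exists A; first by left; split=> //; exact/euclideanE.
    exact/R_isometricE/isoK_sym/real_embK_iso.
  have [I1A|[B I1B BA]] := I1_surj IA nrA.
    exists (realify A); first by right; exists A.
    exact/R_isometricE/isoK_sym/realify_iso.
  (* The chosen representative is the conjugate of [A]; it embeds in [E] as well because [E] is
     real. *)
  have [IB nrB] := I1_mem I1B.
  exists (realify B); first by right; exists B.
  apply/R_isometricE/isoK_sym/realify_iso => //; first exact: I_indec.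
  exact: embK_trans (isoK_emb BA) (embK_conj_real rE eA).
have rr A' B' : I A' -> repK true A' -> I1 B' -> ~ isoK true A' (realify B').
  move=> IA rA /I1_mem[IB nrB]; apply: not_realify_real => //; exact: I_indec.
move=> [[IA /euclideanE rA]|[A' I1A <-]] [[IB /euclideanE rB]|[B' I1B <-]] /R_isometricE iso.
- exact: I_inj (isoK_false iso).
- by case: (rr _ _ IA rA I1B iso).
- by case: (rr _ _ IB rB I1A (isoK_sym iso)).
- by rewrite (I1_inj I1A I1B iso).
Qed.

End CompleteSystem.

(** * Dimensions of indecomposables lie in D(Q) *)

Section ArrowCounts.
Variables (p q : nat) (Q : quiver p q).

(** Each arrow at [l] contributes the dimension at its other end; the nested tests count a loop
    once. *)
Lemma row_arrow_mx (z : 'I_p -> nat) (l : 'I_p) :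
  ((\row_j z j) *m arrow_mx Q) ord0 l =
  (\sum_a (if src Q a == l then z (tgt Q a)
           else if tgt Q a == l then z (src Q a) else 0))%N.
Proof.
rewrite mxE.
have -> : \sum_j (\row_j z j) ord0 j * arrow_mx Q j l =
    (\sum_j \sum_a z j * (if (src Q a == j) && (tgt Q a == l)
       || (src Q a == l) && (tgt Q a == j) then 1 else 0))%N.
  apply: eq_bigr => j _; rewrite !mxE /arrow_count -big_distrr /= -sum1dep_card.
  by rewrite big_mkcond.
rewrite exchange_big; apply: eq_bigr => a _ /=.
have E (j0 : 'I_p) (F : 'I_p -> bool) : (forall j, F j = (j == j0)) ->
    (\sum_j z j * (if F j then 1 else 0) = z j0)%N.
  move=> FE; rewrite (bigD1 j0) //= FE eqxx muln1 big1 ?addn0 // => j /negPf jj0.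
  by rewrite FE jj0 muln0.
have [sl|sl] := eqVneq (src Q a) l; last have [tl|tl] := eqVneq (tgt Q a) l.
- apply: E => j; rewrite sl; have [<-|] := eqVneq (tgt Q a) l.
    by rewrite andbT orbC [j == _]eq_sym orbb eq_sym.
  by rewrite andbF /= eq_sym.
- by apply: E => j; rewrite andbT orbF eq_sym.
- by apply: big1 => j _; rewrite !andbF muln0.
Qed.

End ArrowCounts.

Section Necessity.
Variables (C : numClosedFieldType) (p q : nat) (Q : quiver p q).
Implicit Types (K : bool) (A B D E : rep C Q).

(** For real [M] the real and imaginary parts of [v] both lie in the kernel, and one of them is
    nonzero. *)
Lemma overK_kernel K m n (M : 'M[C]_(m, n)) (v : 'cV_n) :
  overK K M -> v != 0 -> M *m v = 0 ->
  exists w : 'cV_n, [/\ overK K w, w^t* *m w = 1%:M & M *m w = 0].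
Proof.
move=> rM v0 Mv.
have [u [ru u0 Mu]] : exists u : 'cV_n, [/\ overK K u, u != 0 & M *m u = 0].
  case: K rM => [rM|_]; last by exists v; split.
  have vE : v = map_mx (@Re C) v + 'i *: map_mx (@Im C) v.
    by apply/matrixP => i j; rewrite !mxE -Crect.
  have rR : map_mx (@Re C) v \is a realmx.
    by apply/mxOverP => i j; rewrite mxE Creal_Re.
  have rI : map_mx (@Im C) v \is a realmx.
    by apply/mxOverP => i j; rewrite mxE Creal_Im.
  have rMx (x : 'cV_n) : x \is a realmx -> M *m x \is a realmx.
    by move=> rx; apply: (overKM (K := true)) => // _; exact: rM.
  have r0 : (0 : 'cV[C]_m) \is a realmx by exact: (@overK0 C true).
  have /(eqmx_ReiIm (rMx _ rR) (rMx _ rI) r0 r0)[MR MI] :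
      M *m map_mx (@Re C) v + 'i *: (M *m map_mx (@Im C) v) = 0 + 'i *: 0.
    by rewrite scaler0 addr0 scalemxAr -mulmxDr -vE.
  have [R0|R0] := eqVneq (map_mx (@Re C) v) 0; last first.
    by exists (map_mx (@Re C) v); split=> // _.
  exists (map_mx (@Im C) v); split=> //; apply: contra v0 => /eqP I0.
  by rewrite vE R0 I0 scaler0 addr0.
have [s ss /(_ u0) s0] := adj_mulmx_scal u.
have rs : (sqrtC s)^-1 \is Num.real.
  by rewrite rpredV ger0_real// sqrtC_ge0 ltW.
exists ((sqrtC s)^-1 *: u); split; first exact: overKZ.
  rewrite adjmxZ -scalemxAl -scalemxAr ss scalerA (CrealP rs).
  by rewrite -invfM -expr2 sqrtCK scale_scalar_mx mulVf ?lt0r_neq0.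
by rewrite -scalemxAr Mu scaler0.
Qed.

Lemma rank_kernel n (M : 'M[C]_n) : (\rank M < n)%N ->
  exists2 v : 'cV_n, v != 0 & M *m v = 0.
Proof.
move=> rM; have : kermx M^T != 0.
  by rewrite -mxrank_eq0 mxrank_ker mxrank_tr -lt0n subn_gt0.
case/rowV0Pn => u /sub_kermxP uM u0; exists u^T; first by rewrite trmx_eq0.
by rewrite -[LHS]trmxK trmx_mul trmxK uM trmx0.
Qed.

(* [x] spans a subrepresentation of dimension at most one at each vertex. *)
Lemma indecK_line K A (x : forall i, 'cV[C]_(rdim A i)) :
  indecK K A -> (forall i, overK K (x i)) ->
  (forall i, x i = 0 \/ (x i)^t* *m x i = 1%:M) ->
  (forall a, exists2 s, s \is Num.real &
     rmat A a *m x (src Q a) = s *: x (tgt Q a) /\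
     (rmat A a)^t* *m x (tgt Q a) = s *: x (src Q a)) ->
  (exists i, x i != 0) -> forall i, rdim A i = (x i != 0).
Proof.
move=> iA rx x01 xA [i0 xi0].
have hP : homK K (fun i => x i *m (x i)^t*).
  split=> [a|a|i]; last by apply: overKM => //; exact: overK_adj.
    have [s rs [Ax Atx]] := xA a; rewrite mulmxA Ax -mulmxA.
    rewrite -[_^t* *m rmat A a]trmxCK adjmxM trmxCK Atx adjmxZ (CrealP rs).
    by rewrite -scalemxAr -scalemxAl.
  have [s rs [Ax Atx]] := xA a; rewrite mulmxA Atx -mulmxA -adjmxM Ax.
  by rewrite adjmxZ (CrealP rs) -scalemxAr -scalemxAl.
have [i|i|P0|P1 i] := indecK_proj iA hP.
- by rewrite adjmxM trmxCK.
- case: (x01 i) => [->|xx]; first by rewrite !mul0mx.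
  by rewrite mulmxA -(mulmxA _ _ (x i)) xx mulmx1.
- case: (x01 i0) => [xi|xx]; first by rewrite xi eqxx in xi0.
  by move: xi0; rewrite -[x i0]mulmx1 -xx mulmxA P0 mul0mx eqxx.
- case: (x01 i) => [xi|xx].
    have /(congr1 mxrank) := P1 i; rewrite xi mul0mx mxrank0 mxrank1 => <-.
    by rewrite eqxx.
  transitivity 1%N; first exact/esym/(mulmx1_dim_eq xx (P1 i)).
  case: eqP => // xi.
  by move: xx; rewrite xi mulmx0 => /(congr1 mxrank); rewrite mxrank0 mxrank1.
Qed.

(** [conform_mx] transports [v] along the equality [k == i]; its default 0 is never reached, since
    the sizes then agree. *)
Definition vec_at A i (v : 'cV[C]_(rdim A i)) k : 'cV[C]_(rdim A k) :=
  if k == i then conform_mx 0 v else 0.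

Lemma vec_at_id A i (v : 'cV[C]_(rdim A i)) : vec_at v i = v.
Proof. by rewrite /vec_at eqxx conform_mx_id. Qed.

Lemma vec_at_neq A i (v : 'cV[C]_(rdim A i)) k : k != i -> vec_at v k = 0.
Proof. by rewrite /vec_at => /negPf ->. Qed.

Lemma overK_vec_at K A i (v : 'cV[C]_(rdim A i)) k : overK K v -> overK K (vec_at v k).
Proof.
move=> rv; have [->|ki] := eqVneq k i; first by rewrite vec_at_id.
by rewrite vec_at_neq //; exact: overK0.
Qed.

Lemma indecK_kernel K A i (v : 'cV[C]_(rdim A i)) :
  indecK K A -> overK K v -> v^t* *m v = 1%:M ->
  (forall a (e : src Q a = i), rmat A a *m vec_at v (src Q a) = 0) ->
  (forall a (e : tgt Q a = i), (rmat A a)^t* *m vec_at v (tgt Q a) = 0) ->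
  rdim A = unit_vec i.
Proof.
move=> iA rv vv vs vt.
have v0 : v != 0.
  apply/eqP => v0; move: vv; rewrite v0 mulmx0 => /(congr1 mxrank).
  by rewrite mxrank0 mxrank1.
apply/funext => k; rewrite (indecK_line (x := vec_at v) iA) => [|j|j|a|].
- have [->|ki] := eqVneq k i; first by rewrite vec_at_id v0 /unit_vec eqxx.
  by rewrite vec_at_neq // eqxx /unit_vec (negPf ki).
- exact: overK_vec_at.
- have [->|ji] := eqVneq j i; first by right; rewrite vec_at_id.
  by left; exact: vec_at_neq.
- exists 0; first exact: real0.
  rewrite !scale0r; split.
    by have [/vs//|ne] := eqVneq (src Q a) i; rewrite vec_at_neq // mulmx0.
  by have [/vt//|ne] := eqVneq (tgt Q a) i; rewrite vec_at_neq // mulmx0.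
- by exists i; rewrite vec_at_id.
Qed.

(** The vectors at [i] killed by all arrows form the kernel of one positive semidefinite matrix, the
    sum of the Gram matrices [G a]. Its rank is at most [(zM)_i], and for a real representation it
    is real, so a real unit vector can be found in its kernel. *)
Lemma indecK_deficient K A i :
  indecK K A -> (((\row_j rdim A j) *m arrow_mx Q) ord0 i < rdim A i)%N ->
  rdim A = unit_vec i.
Proof.
rewrite row_arrow_mx => iA lt; have [rA _ _] := iA.
pose w a := (if src Q a == i then rdim A (tgt Q a)
           else if tgt Q a == i then rdim A (src Q a) else 0)%N.
(* A loop at [i] alone would contribute [rdim A i] to the sum. *)
have noloop a : src Q a = i -> tgt Q a <> i.
  move=> sa ta; move: lt; rewrite (bigD1 a) //= sa eqxx ta ltnNge.
  by rewrite leq_addr.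
pose G a : 'M[C]_(rdim A i) :=
  if src Q a == i then conform_mx 0 ((rmat A a)^t* *m rmat A a)
  else if tgt Q a == i then conform_mx 0 (rmat A a *m (rmat A a)^t*) else 0.
have rG a : overK K (G a).
  rewrite /G; case: eqP => [<-|_].
    by rewrite conform_mx_id; apply: overKM => //; exact: overK_adj.
  case: eqP => [<-|_]; last exact: overK0.
  by rewrite conform_mx_id; apply: overKM => //; exact: overK_adj.
have rkG a : (\rank (G a) <= w a)%N.
  rewrite /G /w; case: eqP => [<-|_].
    by rewrite conform_mx_id (leq_trans (mxrankM_maxr _ _))// rank_leq_row.
  case: eqP => [<-|_]; last by rewrite mxrank0.
  by rewrite conform_mx_id (leq_trans (mxrankM_maxl _ _))// rank_leq_col.
have rkS : (\rank (\sum_a G a)%R < rdim A i)%N.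
  apply: leq_ltn_trans lt.
  elim/big_ind2: _ => [|m M n N mM nN|a _]; [by rewrite mxrank0| |exact: rkG].
  exact: leq_trans (mxrank_add _ _) (leq_add mM nN).
have [v v0 Gv] := rank_kernel rkS.
have rS : overK K (\sum_a G a).
  elim/big_ind: _ => [|M N|a _]; [exact: overK0|exact: overKD|exact: rG].
have [u [ru uu Gu]] := overK_kernel rS v0 Gv.
have Gpos a : exists2 s : C, u^t* *m G a *m u = s%:M & 0 <= s /\ (s = 0 ->
    (src Q a = i -> rmat A a *m vec_at u (src Q a) = 0) /\
    (tgt Q a = i -> (rmat A a)^t* *m vec_at u (tgt Q a) = 0)).
  have gram m (N : 'M[C]_(m, rdim A i)) : exists2 s : C,
      u^t* *m (N^t* *m N) *m u = s%:M & 0 <= s /\ (s = 0 -> N *m u = 0).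
    have [s ss s0] := adj_mulmx_scal (N *m u).
    exists s; first by rewrite -ss adjmxM !mulmxA.
    have [Nu|Nu] := eqVneq (N *m u) 0; last first.
      by have := s0 Nu; split; [exact: ltW|move=> sE; move: (s0 Nu); rewrite sE ltxx].
    split=> //; have /matrixP/(_ 0 0) := ss; rewrite Nu mulmx0 !mxE eqxx mulr1n.
    by move=> <-.
  rewrite /G; have [si|si] := eqVneq (src Q a) i.
    have ti := noloop a si; clear -si ti gram; move: u gram.
    case: _ / si ti => ti u /(_ _ (rmat A a))[s sE [s0 sN]].
    by exists s; rewrite ?conform_mx_id//; split=> // /sN Nu; rewrite vec_at_id.
  have [ti|ti] := eqVneq (tgt Q a) i; last first.
    exists 0; first by rewrite mulmx0 mul0mx raddf0.
    by split=> // _; split=> e; rewrite e eqxx in si ti.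
  clear -si ti gram; move: u gram.
  case: _ / ti si => /eqP si u /(_ _ ((rmat A a)^t*))[s sE [s0 sN]].
  exists s; first by rewrite conform_mx_id -sE trmxCK.
  by split=> // /sN Nu; rewrite vec_at_id.
pose s a := s2val (cid2 (Gpos a)).
have sE a : u^t* *m G a *m u = (s a)%:M by rewrite /s; case: cid2.
have s0 a : 0 <= s a by rewrite /s; case: cid2 => ? ? [].
have sP a : s a = 0 -> (src Q a = i -> rmat A a *m vec_at u (src Q a) = 0) /\
    (tgt Q a = i -> (rmat A a)^t* *m vec_at u (tgt Q a) = 0).
  by rewrite /s; case: cid2 => ? ? [].
have sum0 : \sum_a s a = 0.
  have := congr1 (mulmx (u^t*)) Gu; rewrite mulmx0 mulmxA mulmx_sumr mulmx_suml.
  under eq_bigr do rewrite sE.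
  by rewrite -raddf_sum => /matrixP/(_ 0 0); rewrite !mxE eqxx mulr1n.
have sz a : s a = 0.
  by move/eqP: sum0; rewrite psumr_eq0 // => /allP/(_ a (mem_index_enum _))/eqP.
apply: (indecK_kernel iA ru uu) => a e; by [apply: (sP a (sz a)).1|apply: (sP a (sz a)).2].
Qed.

Lemma rmat_dim0_src A a : rdim A (src Q a) = 0%N -> rmat A a = 0.
Proof.
move=> s0; apply/matrixP => i j; exfalso.
by have := leq_ltn_trans (leq0n _) (ltn_ord j); rewrite s0.
Qed.

Lemma rmat_dim0_tgt A a : rdim A (tgt Q a) = 0%N -> rmat A a = 0.
Proof.
move=> s0; apply/matrixP => i j; exfalso.
by have := leq_ltn_trans (leq0n _) (ltn_ord i); rewrite s0.
Qed.

Lemma homK_indicator K A (b : pred 'I_p) :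
  (forall a, b (src Q a) != b (tgt Q a) -> rmat A a = 0) ->
  homK K (fun i => (b i)%:R%:M : 'M_(rdim A i)).
Proof.
move=> bA; split=> [a|a|i]; last exact/overK_scalar/realn.
  have [e|/bA ->] := eqVneq (b (src Q a)) (b (tgt Q a)).
    by rewrite e scalar_mxC.
  by rewrite mulmx0 mul0mx.
have [e|/bA ->] := eqVneq (b (src Q a)) (b (tgt Q a)).
  by rewrite e scalar_mxC.
by rewrite adjmx0 mulmx0 mul0mx.
Qed.

(** If no nonzero matrix crosses the boundary of [b], its indicator is a projection endomorphism.
    This gives connectedness of the support and the nonvanishing of the arrow of a segment. *)
Lemma indecK_indicator K A (b : pred 'I_p) :
  indecK K A -> (forall a, b (src Q a) != b (tgt Q a) -> rmat A a = 0) ->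
  forall i j, rdim A i != 0%N -> rdim A j != 0%N -> b i -> b j.
Proof.
move=> iA bA i j Ai Aj bi.
have one k : (1%:M : 'M[C]_(rdim A k)) = 0 -> rdim A k = 0%N.
  by move/(congr1 mxrank); rewrite mxrank0 mxrank1.
have [k|k|P0|P1] := indecK_proj iA (homK_indicator K bA).
- by rewrite adjmx_scalar conjC_nat.
- by rewrite -scalar_mxM -natrM mulnb andbb.
- by have := P0 i; rewrite bi => /one/eqP; rewrite (negPf Ai).
- have := P1 j; case: (b j) => //; rewrite raddf0 => /esym/one/eqP.
  by rewrite (negPf Aj).
Qed.

Lemma supp_adj_sym (z : 'I_p -> nat) : connect_sym (supp_adj Q z).
Proof.
apply: sym_connect_sym => i j; apply: eq_existsb => a.
by rewrite orbC.
Qed.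

Lemma supp_verticesE (z : 'I_p -> nat) i : (i \in supp_vertices z) = (z i != 0%N).
Proof. by rewrite inE. Qed.

Lemma indecK_connected K A : indecK K A -> supp_connected Q (rdim A).
Proof.
move=> iA i j; rewrite !supp_verticesE => Ai Aj.
apply: (indecK_indicator iA (b := connect (supp_adj Q (rdim A)) i) _ Ai Aj (connect0 _ _)).
move=> a ne; have [/rmat_dim0_src//|sa] := eqVneq (rdim A (src Q a)) 0%N.
have [/rmat_dim0_tgt//|ta] := eqVneq (rdim A (tgt Q a)) 0%N.
case/negP: ne; apply/eqP/same_connect_r; first exact: supp_adj_sym.
apply: connect1; apply/existsP; exists a.
by rewrite inE !supp_verticesE sa ta !eqxx.
Qed.

Lemma indecK_segment K A : indecK K A -> supp_segment Q (rdim A) ->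
  exists i j, arrow_mx Q i j = 1%N /\
    rdim A = (fun k => unit_vec i k + unit_vec j k)%N.
Proof.
move=> iA [card2 [a aE st]]; have [rA _ _] := iA.
pose i := src Q a; pose j := tgt Q a; exists i, j.
have : a \in supp_arrows Q (rdim A) by rewrite aE inE.
rewrite inE !supp_verticesE => /andP[Ai Aj].
have suppE k : (k \in supp_vertices (rdim A)) = (k == i) || (k == j).
  have /eqP <- : [set i; j]%SET == supp_vertices (rdim A).
    rewrite eqEcard cards2 st card2 leqnn andbT; apply/fintype.subsetP => l.
    by rewrite !inE => /orP[] /eqP ->; rewrite ?Ai ?Aj.
  by rewrite !inE.
have zero b : b != a -> rmat A b = 0.
  move=> ba; have [/rmat_dim0_src//|sa] := eqVneq (rdim A (src Q b)) 0%N.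
  have [/rmat_dim0_tgt//|ta] := eqVneq (rdim A (tgt Q b)) 0%N.
  have : b \in supp_arrows Q (rdim A) by rewrite inE !supp_verticesE sa ta.
  by rewrite aE inE (negPf ba).
split.
  rewrite mxE /arrow_count (_ : [set _ | _]%SET = [set a]%SET) ?cards1 //.
  apply/setP => b; rewrite !inE; apply/idP/eqP => [|->]; last by rewrite !eqxx.
  move=> sb; have : b \in supp_arrows Q (rdim A).
    rewrite inE !supp_verticesE.
    by case/orP: sb => /andP[/eqP -> /eqP ->]; rewrite ?Ai ?Aj.
  by rewrite aE inE => /eqP.
have Aa0 : rmat A a != 0.
  apply/eqP => Aa0; have : j == i; last by rewrite eq_sym (negPf st).
  apply: (indecK_indicator iA (b := pred1 i) _ Ai Aj (eqxx i)) => b _.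
  by have [->|/zero] := eqVneq b a.
have sH : ((rmat A a)^t* *m rmat A a)^t* = (rmat A a)^t* *m rmat A a.
  by rewrite adjmxM trmxCK.
have [U1 HE rd] := herm_spectral sH.
move: (spectralmx _) (spectral_diag _) U1 HE rd => U d UU HE rd.
have [k dk] : exists k, d 0 k != 0.
  apply: contrapT => no; case/eqP: Aa0; apply: mulmx_adj_eq0.
  rewrite HE (_ : d = 0) ?raddf0 ?mulmx0 ?mul0mx //.
  apply/rowP => k; rewrite mxE; apply/eqP/negPn/negP => dk; apply: no.
  by exists k.
(* The kernel of [N] is the eigenspace of a nonzero squared singular value. The eigenvalue is real,
   so [N] is real with [A], and a real singular vector [u] exists. *)
pose N := (rmat A a)^t* *m rmat A a - (d 0 k)%:M.
have rN : overK K N.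
  apply: overKD; first by apply: overKM => //; exact: overK_adj.
  exact/overKN/overK_scalar/(mxOverP rd).
have v0 : col k (U^t*) != 0.
  apply/eqP; rewrite colE => /(congr1 (mulmx U)).
  rewrite mulmxA UU mul1mx mulmx0 => /matrixP/(_ k 0); rewrite !mxE !eqxx.
  by move/eqP; rewrite oner_eq0.
have Nv : N *m col k (U^t*) = 0.
  rewrite mulmxBl HE colE mulmxA -(mulmxA _ U) UU mulmx1 -mulmxA.
  have -> : diag_mx d *m delta_mx k 0 = d 0 k *: (delta_mx k 0 : 'cV_(rdim A (src Q a))).
    apply/matrixP => x y; rewrite mul_diag_mx !mxE.
    by case: eqP => [->|]; rewrite ?andbF ?mulr0 //= !mulr0.
  by rewrite -scalemxAr mul_scalar_mx subrr.
have [u [ru uu Nu]] := overK_kernel rN v0 Nv.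
have Hu : (rmat A a)^t* *m (rmat A a *m u) = d 0 k *: u.
  by move/eqP: Nu; rewrite mulmxBl subr_eq0 mul_scalar_mx -mulmxA => /eqP.
have gu : (rmat A a *m u)^t* *m (rmat A a *m u) = (d 0 k)%:M.
  by rewrite adjmxM -mulmxA Hu -scalemxAr uu scalemx1.
have dpos : 0 < d 0 k.
  have [s ss s0] := adj_mulmx_scal (rmat A a *m u).
  have sE : s = d 0 k.
    have /matrixP/(_ 0 0) := ss; rewrite gu !mxE eqxx !mulr1n //.
  rewrite -sE; apply: s0; apply: contra dk => /eqP Au0; apply/eqP.
  by have /matrixP/(_ 0 0) := gu; rewrite Au0 mulmx0 !mxE eqxx mulr1n.
pose s := sqrtC (d 0 k).
have s0 : 0 < s by rewrite sqrtC_gt0.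
have rs : s \is Num.real by exact: gtr0_real.
have ss : s * s = d 0 k by rewrite -expr2 sqrtCK.
(* [u] and [w] are paired by the singular value [s]: the arrow sends [u] to [s w], its adjoint sends
   [w] to [s u]. *)
pose w := s^-1 *: (rmat A a *m u).
have ww : w^t* *m w = 1%:M.
  rewrite /w adjmxZ -scalemxAl -scalemxAr gu scalerA (CrealP _) ?rpredV //.
  by rewrite -invfM ss scale_scalar_mx mulVf.
have nz m (x : 'cV[C]_m) : x^t* *m x = 1%:M -> x != 0.
  move=> xx; apply/eqP => x0; move: xx; rewrite x0 mulmx0 => /(congr1 mxrank).
  by rewrite mxrank0 mxrank1.
pose x k := vec_at (i := i) u k + vec_at (i := j) w k.
have ij : i != j by [].
have xi : x i = u by rewrite /x vec_at_id vec_at_neq // addr0.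
have xj : x j = w by rewrite /x vec_at_id vec_at_neq 1?eq_sym // add0r.
have xo l : l != i -> l != j -> x l = 0.
  by move=> li lj; rewrite /x !vec_at_neq // addr0.
apply/funext => l; rewrite (indecK_line (x := x) iA) => [|m|m|b|].
- rewrite /unit_vec; have [->|li] := eqVneq l i; first by rewrite xi nz // (negPf ij).
  have [->|lj] := eqVneq l j; first by rewrite xj nz.
  by rewrite xo // eqxx.
- apply: overKD; apply: overK_vec_at => //; apply: overKZ; rewrite ?rpredV //.
  exact: overKM (rA a) ru.
- have [->|li] := eqVneq m i; first by right; rewrite xi.
  have [->|lj] := eqVneq m j; first by right; rewrite xj.
  by left; exact: xo.
- have [->|/zero ->] := eqVneq b a; last first.
    by exists 0; rewrite ?real0 // adjmx0 !mul0mx !scale0r.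
  exists s => //; rewrite -/i -/j xi xj; split.
    by rewrite /w scalerA mulfV ?scale1r // lt0r_neq0.
  by rewrite /w -scalemxAr Hu scalerA -ss mulKf // lt0r_neq0.
- by exists i; rewrite xi nz.
Qed.

Lemma indecK_DQ K A : indecK K A -> DQ Q (rdim A).
Proof.
move=> iA; have [_ nA _] := iA.
have [[i lt]|no] := EM (exists i,
    (((\row_j rdim A j) *m arrow_mx Q) ord0 i < rdim A i)%N).
  by apply: Or31; exists i; exact: indecK_deficient iA lt.
have [seg|nseg] := EM (supp_segment Q (rdim A)).
  by apply: Or32; exact: indecK_segment iA seg.
have le i : (rdim A i <= ((\row_j rdim A j) *m arrow_mx Q) ord0 i)%N.
  by rewrite leqNgt; apply/negP => lt; apply: no; exists i.
apply: Or33; split=> //; last 2 first.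
- exact: indecK_connected iA.
(* If the support is a point without arrows, every arrow at [i] has dimension 0 at its other end, so
   [(zM)_i = 0], against [le i]. *)
- move=> [/eqP/cards1P[i supE] arr0].
  have : i \in supp_vertices (rdim A) by rewrite supE inE.
  rewrite supp_verticesE => Ai; have := le i.
  rewrite row_arrow_mx big1 ?leqn0 ?(negPf Ai) // => a _.
  have : a \notin supp_arrows Q (rdim A) by rewrite arr0 inE.
  rewrite inE !supp_verticesE negb_and !negbK.
  case: (src Q a =P i) => [-> |_]; first by rewrite (negPf Ai) => /eqP.
  by case: (tgt Q a =P i) => [->|//]; rewrite (negPf Ai) orbF => /eqP.
by have [i Ai] := not_dim0 nA; exists i; exact/eqP.
Qed.

End Necessity.

(** * Every vector in D(Q) is a dimension *)

(** Intervals of lengths [r h] are laid end to end and wrapped around modulo [n]: length at most [n]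
    gives injectivity, total length at least [n] gives the covering. *)
Lemma index_cover (H : eqType) (s : seq H) (r : H -> nat) (n : nat) :
  uniq s -> (forall h, h \in s -> (r h <= n)%N) -> (n <= \sum_(h <- s) r h)%N ->
  exists th : H -> nat -> nat,
    [/\ forall h k, h \in s -> (k < r h)%N -> (th h k < n)%N,
        forall h k l, h \in s -> (k < r h)%N -> (l < r h)%N ->
          th h k = th h l -> k = l
      & forall t, (t < n)%N ->
          exists h k, [/\ h \in s, (k < r h)%N & th h k = t]].
Proof.
move=> us rn sn.
pose o h := (\sum_(h' <- take (index h s) s) r h')%N.
exists (fun h k => (o h + k) %% n)%N; split=> [h k hs kr|h k l hs kr lr|t tn].
- by rewrite ltn_mod; apply: leq_trans (rn _ hs); exact: leq_ltn_trans kr.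
- move=> /eqP; rewrite eqn_modDl => /eqP.
  by rewrite !modn_small // (leq_trans _ (rn _ hs)).
have [h [k [hs kr E]]] : exists h k, [/\ h \in s, (k < r h)%N & (o h + k)%N = t].
  have := leq_trans tn sn; rewrite /o; clear -us.
  elim: s t us => [|h s IH] t; first by rewrite big_nil.
  move=> /= /andP[hns us]; rewrite big_cons => lt.
  have [tr|tr] := ltnP t (r h).
    by exists h, t; rewrite eqxx take0 big_nil mem_head.
  have [|h' [k [h's kr E]]] := IH (t - r h)%N us; first by rewrite ltn_subLR.
  exists h', k; rewrite in_cons h's orbT; split=> //.
  have [hh|_] := eqVneq h h'; first by rewrite hh h's in hns.
  by rewrite big_cons -addnA E subnKC.
by exists h, k; rewrite E modn_small.
Qed.

(** * An integer reflection and the eigenvectors it forces *)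

Section Reflections.
Variable C : numClosedFieldType.

(* The entry 2 makes the squared length odd when [n] is even. *)
Definition oddvec n (t : 'I_n) : nat := if (val t == 0%N) && ~~ odd n then 2 else 1.

Definition oddlen n : nat := \sum_t (oddvec (n := n) t) ^ 2.

Lemma odd_oddlen n : (0 < n)%N -> odd (oddlen n).
Proof.
case: n => // n _; rewrite /oddlen big_ord_recl /=.
under eq_bigr do rewrite /oddvec /= exp1n.
rewrite sum1_card card_ord /oddvec /=.
by case o : (odd n); rewrite /= oddD /= o.
Qed.

Lemma oddvec_gt0 n (t : 'I_n) : (0 < oddvec t)%N.
Proof. by rewrite /oddvec; case: ifP. Qed.

Definition oddcol n : 'cV[C]_n := \col_t (oddvec t)%:R.

(* A multiple of an orthogonal reflection; its entries are integers congruent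
   to those of the identity matrix modulo 2 and are all nonzero. *)
Definition reflmx n : 'M[C]_n :=
  (oddlen n)%:R%:M - 2%:R *: (oddcol n *m (oddcol n)^T).

Lemma reflmxE n (t u : 'I_n) :
  reflmx n t u = (oddlen n)%:R *+ (t == u) - 2%:R * ((oddvec t)%:R * (oddvec u)%:R).
Proof. by rewrite !mxE big_ord1 !mxE. Qed.

Lemma reflmx_neq0 n (t u : 'I_n) : reflmx n t u != 0.
Proof.
rewrite reflmxE -!natrM; have [->|tu] := eqVneq t u.
  have n0 : (0 < n)%N := leq_ltn_trans (leq0n _) (ltn_ord u).
  rewrite mulr1n subr_eq0 eqr_nat; apply: contraTneq (odd_oddlen n0) => ->.
  by rewrite mul2n odd_double.
by rewrite mulr0n sub0r oppr_eq0 pnatr_eq0 !muln_eq0 !negb_or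
  -!lt0n !oddvec_gt0.
Qed.

Lemma oddcol_gram n : (oddcol n)^T *m oddcol n = (oddlen n)%:R%:M.
Proof.
apply/matrixP => i j; rewrite !ord1 !mxE mulr1n /oddlen natr_sum.
by apply: eq_bigr => t _; rewrite !mxE natrX expr2.
Qed.

Lemma reflmx_adj n : (reflmx n)^t* = reflmx n.
Proof.
apply/matrixP => t u; rewrite [LHS]mxE [_^T _ _]mxE !reflmxE eq_sym rmorphB rmorphMn/=.
by rewrite !rmorphM /= !conjC_nat [_ * (oddvec u)%:R]mulrC.
Qed.

Lemma reflmx_sqr n : reflmx n *m reflmx n = ((oddlen n)%:R ^+ 2)%:M.
Proof.
set s := (oddlen n)%:R; set v := oddcol n.
have vv : v *m v^T *m (v *m v^T) = s *: (v *m v^T).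
  by rewrite mulmxA -(mulmxA v) oddcol_gram -/s mul_mx_scalar -scalemxAl.
rewrite /reflmx -/s -/v; move: (v *m v^T) vv => M MM.
rewrite mulmxBl !mulmxBr -!scalemxAl -!scalemxAr MM -scalar_mxM mul_scalar_mx.
rewrite mul_mx_scalar -expr2 !scalerA opprB addrA.
apply/matrixP => i j; rewrite !mxE; ring.
Qed.

(* Since no entry of [reflmx] vanishes, every standard basis vector is linked to
   every reflected one and all eigenvalues coincide; since [reflmx] is the
   identity modulo 2, the eigenvectors span. *)
Lemma local_scalar n (P : 'M[C]_n) (T1 T2 : 'I_n -> Prop) :
  P^t* = P ->
  (forall t, T1 t -> exists c, forall k, P k t = c *+ (k == t)) ->
  (forall t, T2 t -> exists c, forall k, (P *m reflmx n) k t = c * reflmx n k t) ->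
  (exists t, T1 t) -> (exists t, T2 t) -> (forall t, T1 t \/ T2 t) ->
  exists c, P = c%:M.
Proof.
move=> hP h1 h2 [t0 T1t0] [u0 T2u0] cover.
have Pt t k : T1 t -> P t k = P t t *+ (k == t).
  move=> /h1[c cE]; have tt : P t t = c by rewrite cE eqxx.
  have rc : c^* = c by rewrite -tt -{2}hP !mxE.
  by rewrite -hP !mxE !cE eqxx mulr1n rmorphMn/= !rc.
have row t u : T1 t -> (P *m reflmx n) t u = P t t * reflmx n t u.
  move=> T1t; rewrite mxE (bigD1 t) //= Pt // eqxx mulr1n big1 ?addr0 // => k kt.
  by rewrite Pt // (negPf kt) mulr0n mul0r.
have same t u c : T1 t -> (forall k, (P *m reflmx n) k u = c * reflmx n k u) -> c = P t t.
  by move=> T1t /(_ t); rewrite row // => /(mulIf (reflmx_neq0 _ _)).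
have [c cE] := h2 u0 T2u0; exists c.
have c1 t : T1 t -> P t t = c by move=> T1t; rewrite (same t u0 c).
have c2 u : T2 u -> forall k, (P *m reflmx n) k u = c * reflmx n k u.
  move=> /h2[c' c'E] k; rewrite c'E; congr (_ * _).
  by rewrite (same t0 u c') // c1.
pose N := P - c%:M.
have N1 t k : T1 t -> N k t = 0.
  move=> T1t; have [d dE] := h1 t T1t; rewrite !mxE dE.
  have := dE t; rewrite c1 // eqxx mulr1n => ->.
  by case: (k == t); rewrite ?mulr1n ?mulr0n subrr.
pose s : C := (oddlen n)%:R; pose v (t : 'I_n) : C := (oddvec t)%:R.
pose y k := \sum_t N k t * v t.
(* Entry [(k, u)] of [N *m reflmx n], which vanishes, is [s * N k u - 2 * y k * v u]. *)
have N2 u k : T2 u -> s * N k u = 2%:R * y k * v u.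
  move=> T2u; have : (N *m reflmx n) k u = 0.
    by rewrite mulmxBl mul_scalar_mx [LHS]mxE c2 // !mxE subrr.
  rewrite mxE; under eq_bigr do rewrite reflmxE mulrBr.
  rewrite sumrB (bigD1 u) //= eqxx mulr1n big1 ?addr0; last first.
    by move=> i /negPf ->; rewrite mulr0n mulr0.
  move/eqP; rewrite subr_eq0 mulrC => /eqP ->.
  rewrite /y mulr_sumr mulr_suml; apply: eq_bigr => i _; rewrite /v; ring.
have n0 : (0 < n)%N := leq_ltn_trans (leq0n _) (ltn_ord t0).
(* Weighting [N2] by [v] and summing over the indices outside [T1], where alone [N] can be nonzero,
   gives [s * y k] equal to an even integer times [y k]; but [s] is odd. *)
have y0 k : y k = 0.
  pose T1b t := `[< T1 t >].
  have : s * y k = 2%:R * y k * (\sum_(t | ~~ T1b t) oddvec t ^ 2)%:R.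
    rewrite /y mulr_sumr (bigID T1b) /= big1 ?add0r; last first.
      by move=> t /asboolP/N1 ->; rewrite mul0r mulr0.
    rewrite natr_sum mulr_sumr; apply: eq_bigr => t /asboolP nT1t.
    have T2t : T2 t by case: (cover t).
    by rewrite mulrA N2 // natrX -/(v t) expr2 mulrA.
  move/eqP; rewrite mulrAC -subr_eq0 -mulrBl mulf_eq0 => /orP[|/eqP//].
  rewrite /s -natrM subr_eq0 eqr_nat => /eqP e.
  by have := odd_oddlen n0; rewrite e mul2n odd_double.
have s0 : s != 0.
  rewrite pnatr_eq0; apply: contraTneq (odd_oddlen n0) => ->//.
apply/eqP; rewrite -subr_eq0; apply/eqP/matrixP => k u; rewrite [RHS]mxE.
have [/N1//|T2u] := cover u.
by have /eqP := N2 u k T2u; rewrite y0 mulr0 mul0r mulf_eq0 (negPf s0) => /eqP.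
Qed.

Lemma mul_mx_diag_inj m n (A B : 'M[C]_(m, n)) (d : 'rV_n) :
  (forall k, d 0 k != 0) -> A *m diag_mx d = B *m diag_mx d -> A = B.
Proof.
move=> d0 /matrixP AB; apply/matrixP => i k; apply: (mulIf (d0 k)).
by have := AB i k; rewrite !mul_mx_diag !mxE.
Qed.

(** The columns of [W] are eigenvectors of [W *m diag_mx d *m W^t*] for the distinct nonzero
    eigenvalues [c * d 0 k], so a matrix commuting with it preserves each of these lines. *)
Lemma gram_eigen n r (W : 'M[C]_(n, r)) (d : 'rV[C]_r) (c : C) (P : 'M[C]_n) :
  W^t* *m W = c%:M -> c != 0 -> injective (d 0) -> (forall k, d 0 k != 0) ->
  P *m (W *m diag_mx d *m W^t*) = (W *m diag_mx d *m W^t*) *m P ->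
  exists e : 'rV_r, P *m W = W *m diag_mx e.
Proof.
move=> WW c0 dinj d0 PG; pose Y := W^t* *m P *m W.
have GW : W *m diag_mx d *m W^t* *m W = c *: (W *m diag_mx d).
  by rewrite -mulmxA WW mul_mx_scalar.
have PWd : c *: (P *m W *m diag_mx d) = W *m diag_mx d *m Y.
  rewrite -mulmxA scalemxAr -GW mulmxA PG /Y !mulmxA//.
have Yd : Y *m diag_mx d = diag_mx d *m Y.
  have := congr1 (mulmx (W^t*)) PWd; rewrite -scalemxAr !mulmxA WW -/Y.
  rewrite mul_scalar_mx -!scalemxAl => /(congr1 (fun M => c^-1 *: M)).
  by rewrite !scalerA mulVf // !scale1r.
have Yoff k l : k != l -> Y k l = 0.
  move=> kl; have /matrixP/(_ k l) := Yd.
  rewrite mul_mx_diag mul_diag_mx mxE [RHS]mxE mulrC => /eqP.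
  rewrite -subr_eq0 -mulrBl mulf_eq0 subr_eq0 => /orP[/eqP/dinj e|/eqP//].
  by rewrite e eqxx in kl.
have YE : Y = diag_mx (\row_k Y k k).
  apply/matrixP => k l; rewrite [RHS]mxE [(\row_k _) 0 k]mxE.
  by have [->|kl] := eqVneq k l; rewrite ?mulr1n // Yoff.
exists (c^-1 *: \row_k Y k k); rewrite linearZ /= -YE -scalemxAr.
have /(mul_mx_diag_inj d0) <- : (c *: (P *m W)) *m diag_mx d = (W *m Y) *m diag_mx d.
  by rewrite -scalemxAl PWd -(mulmxA W Y) Yd mulmxA.
by rewrite scalerA mulVf // scale1r.
Qed.

End Reflections.

Lemma connect_closed (T : finType) (e : rel T) (S : T -> Prop) x y :
  (forall u v, S u -> e u v -> S v) -> S x -> connect e x y -> S y.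
Proof.
move=> Se Sx /connectP[s es ->]; elim: s x Sx es => //= u s IH x Sx /andP[xu us].
exact: IH (Se _ _ Sx xu) us.
Qed.

(** * Half-edges of the support *)

Section HalfEdges.
Variables (p q : nat) (Q : quiver p q) (z : 'I_p -> nat).

(* [(a, false)] and [(a, true)] are the half-edges of the arrow [a] at its
   source and at its target. *)
Definition hend (h : 'I_q * bool) : 'I_p := if h.2 then tgt Q h.1 else src Q h.1.

Definition hopp (h : 'I_q * bool) := (h.1, ~~ h.2).

(** The largest rank that a matrix on the arrow can have; the realizing matrices attain it. *)
Definition hrank (a : 'I_q) := minn (z (src Q a)) (z (tgt Q a)).

Lemma hrank_le h : (hrank h.1 <= z (hend h))%N.
Proof. by case: h => a [] /=; rewrite ?geq_minl ?geq_minr. Qed.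

Lemma hrank_gt0 a : (0 < hrank a)%N = (z (src Q a) != 0%N) && (z (tgt Q a) != 0%N).
Proof. by rewrite leq_min !lt0n. Qed.

Lemma supp_arrowsE a : (a \in supp_arrows Q z) = (0 < hrank a)%N.
Proof. by rewrite inE !inE hrank_gt0. Qed.

Lemma supp_adjP k l : supp_adj Q z k l ->
  exists h, [/\ hend h = k, hend (hopp h) = l & (0 < hrank h.1)%N].
Proof.
case/existsP => a /andP[]; rewrite supp_arrowsE => ra.
case/orP => /andP[/eqP sa /eqP ta]; first by exists (a, false).
by exists (a, true).
Qed.

(** Either one half-edge at [l] already has rank [z l], as a loop does, or at each arrow the minimum
    is the dimension at the far end, and the ranks add up to at least [(zM)_l]. *)
Lemma half_edge_sum : (forall l, (z l <= ((\row_j z j) *m arrow_mx Q) ord0 l)%N) ->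
  forall l, (z l <= \sum_(h | hend h == l) hrank h.1)%N.
Proof.
move=> zM l; have [/existsP[h /andP[hl zh]]|none] :=
  boolP [exists h, (hend h == l) && (z l <= hrank h.1)%N].
  by rewrite (bigD1 h) //=; apply: leq_trans zh (leq_addr _ _).
have small h : hend h == l -> (hrank h.1 < z l)%N.
  move=> hl; rewrite ltnNge; apply: contra none => zh.
  by apply/existsP; exists h; rewrite hl.
apply: leq_trans (zM l) _; rewrite row_arrow_mx.
have -> : (\sum_(h | hend h == l) hrank h.1 =
    \sum_a \sum_b (if hend (a, b) == l then hrank a else 0))%N.
  by rewrite big_mkcond pair_bigA /=; apply: eq_bigr => -[].
apply: leq_sum => a _; rewrite big_bool /=.
have := small (a, false); have := small (a, true); rewrite /hend /hrank /=.
have [<-|_] := eqVneq (src Q a) l.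
  by move=> _ /(_ isT); rewrite gtn_min ltnn /= => lt; rewrite (minn_idPr (ltnW lt)) leq_addl.
have [<-|//] := eqVneq (tgt Q a) l.
by move=> /(_ isT); rewrite gtn_min ltnn orbF => lt _; rewrite (minn_idPl (ltnW lt)) leq_addr.
Qed.

Definition hpick l := [pick h | (hend h == l) && (0 < hrank h.1)%N].

Lemma hpickP l : (forall l, (z l <= ((\row_j z j) *m arrow_mx Q) ord0 l)%N) ->
  z l != 0%N -> exists h, [/\ hpick l = Some h, hend h = l & (0 < hrank h.1)%N].
Proof.
move=> zM zl; rewrite /hpick; case: pickP => [h /andP[/eqP hl rh]|none].
  by exists h.
have := half_edge_sum zM l; rewrite big1 ?leqn0 ?(negPf zl) // => h hl.
by have := none h; rewrite hl /= lt0n => /negbFE/eqP.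
Qed.

(** The two ends of [h] are closed under adjacency, hence by connectedness they are the whole
    support. *)
Lemma two_leaves_segment h :
  supp_connected Q z -> (0 < hrank h.1)%N ->
  (forall h', hend h' = hend h -> (0 < hrank h'.1)%N -> h' = h) ->
  (forall h', hend h' = hend (hopp h) -> (0 < hrank h'.1)%N -> h' = hopp h) ->
  supp_segment Q z.
Proof.
move=> conn rh u1 u2.
have zh : z (hend h) != 0%N.
  by rewrite -lt0n; exact: leq_trans rh (hrank_le h).
have zh' : z (hend (hopp h)) != 0%N.
  by rewrite -lt0n; exact: leq_trans rh (hrank_le (hopp h)).
have ne : hend h != hend (hopp h).
  apply/eqP => e; have := u1 (hopp h) (esym e) rh.
  by case: h {u1 u2 rh zh zh' e} => a [].
have suppE k : k \in supp_vertices z -> k = hend h \/ k = hend (hopp h).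
  move=> zk; have hs : hend h \in supp_vertices z by rewrite inE.
  apply: (connect_closed (S := fun k => k = hend h \/ k = hend (hopp h)) _ _ (conn _ _ hs zk)).
    move=> u v [] -> /supp_adjP[h' [e <- r]].
      by right; rewrite (u1 _ e r).
    by left; rewrite (u2 _ e r); case: (h) => a b; rewrite /hopp /= negbK.
  by left.
split.
  rewrite (_ : supp_vertices z = [set hend h; hend (hopp h)]%SET) ?cards2 ?ne //.
  apply/setP => k; rewrite !inE; apply/idP/orP => [zk|[/eqP ->|/eqP ->]//].
  by case: (suppE k) => [|->|->]; rewrite ?inE // eqxx; [left|right].
exists h.1; last by case: h ne {rh u1 u2 zh zh' suppE} => a [] //=; rewrite eq_sym.
apply/setP => a; rewrite supp_arrowsE inE; apply/idP/eqP => [ra|->//].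
have sa : src Q a \in supp_vertices z.
  by move: ra; rewrite hrank_gt0 inE => /andP[].
have [e|e] := suppE _ sa; first by rewrite -(u1 (a, false) e ra).
by rewrite -[RHS]/((hopp h).1) -(u2 (a, false) e ra).
Qed.

End HalfEdges.

(** * Matrices with prescribed singular vectors *)

Section Sandwich.
Variable C : numClosedFieldType.
Variables (m n r : nat) (V : 'M[C]_(m, r)) (D : 'M[C]_r) (W : 'M[C]_(n, r)).

Lemma sandwich_adj : D^t* = D -> (V *m D *m W^t*)^t* = W *m D *m V^t*.
Proof. by move=> sD; rewrite !adjmxM trmxCK sD mulmxA. Qed.

Lemma sandwich_gram c : V^t* *m V = c%:M -> D^t* = D ->
  (V *m D *m W^t*)^t* *m (V *m D *m W^t*) = c *: (W *m (D *m D) *m W^t*).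
Proof.
move=> VV sD; rewrite sandwich_adj // !mulmxA -(mulmxA _ _ V) VV.
by rewrite mul_mx_scalar -!scalemxAl.
Qed.

Lemma sandwich_mul_eq0 k c (X : 'M_(n, k)) : V^t* *m V = c%:M -> c != 0 ->
  V *m D *m W^t* *m X = 0 -> D *m (W^t* *m X) = 0.
Proof.
move=> VV c0 /(congr1 (mulmx (V^t*))); rewrite -!mulmxA [V^t* *m _]mulmxA VV mulmx0.
by rewrite mul_scalar_mx => /eqP; rewrite scalemx_eq0 (negPf c0) => /eqP.
Qed.

Lemma sandwich_eq0 c c' : V^t* *m V = c%:M -> W^t* *m W = c'%:M ->
  c != 0 -> c' != 0 -> V *m D *m W^t* = 0 -> D = 0.
Proof.
move=> VV WW c0 c'0 /(congr1 (mulmx^~ W)); rewrite mul0mx.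
move=> /(sandwich_mul_eq0 VV c0)/eqP.
by rewrite WW mul_mx_scalar scalemx_eq0 (negPf c'0) => /eqP.
Qed.

End Sandwich.

Section Realization.
Variables (C : numClosedFieldType) (p q : nat) (Q : quiver p q) (z : 'I_p -> nat).
Variables (th : 'I_q * bool -> nat -> nat) (std : pred ('I_q * bool)).
Local Notation hend := (hend Q).
Local Notation hrank := (hrank Q z).
Hypothesis th_lt : forall h k, (k < hrank h.1)%N -> (th h k < z (hend h))%N.
Hypothesis th_inj : forall h k l, (k < hrank h.1)%N -> (l < hrank h.1)%N ->
  th h k = th h l -> k = l.

Definition selmx n r (f : nat -> nat) : 'M[C]_(n, r) := \matrix_(t, k) (val t == f k)%:R.

Lemma mul_selmx m n r (f : nat -> nat) (M : 'M[C]_(m, n)) i (k : 'I_r) (t : 'I_n) :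
  val t = f k -> (M *m selmx n r f) i k = M i t.
Proof.
move=> tf; rewrite mxE (bigD1 t) //= mxE tf eqxx mulr1 big1 ?addr0 // => u ut.
by rewrite mxE -tf (inj_eq val_inj) (negPf ut) mulr0.
Qed.

(* At each vertex one half-edge, marked by [std], gets vectors of the standard
   basis and the other ones get columns of [reflmx]. *)
Definition frame_base h : 'M[C]_(z (hend h)) := if std h then 1%:M else reflmx C _.

Fact frame_key : unit. Proof. exact: tt. Qed.

Definition frame h : 'M[C]_(z (hend h), hrank h.1) :=
  locked_with frame_key (frame_base h *m selmx _ _ (th h)).

Lemma frame_unlock h : frame h = frame_base h *m selmx _ _ (th h).
Proof. by rewrite /frame unlock. Qed.

Lemma frameE h i (k : 'I_(hrank h.1)) (t : 'I_(z (hend h))) :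
  val t = th h k -> frame h i k = frame_base h i t.
Proof. by rewrite frame_unlock; exact: mul_selmx. Qed.

Lemma frame_gram h : exists2 c, c != 0 & (frame h)^t* *m frame h = c%:M.
Proof.
have sel1 : (selmx (z (hend h)) (hrank h.1) (th h))^t* *m selmx _ _ (th h) = 1%:M.
  apply/matrixP => k l; rewrite (mul_selmx _ _ (t := Ordinal (th_lt (ltn_ord l)))) //.
  rewrite !mxE /= conjC_nat; congr (_%:R).
  have [->|kl] := eqVneq k l; first by rewrite eqxx.
  by case: eqP => // /(th_inj (ltn_ord l) (ltn_ord k)) /val_inj e; rewrite e eqxx in kl.
have base : exists2 c, (frame_base h)^t* *m frame_base h = c%:M & (0 < z (hend h))%N -> c != 0.
  rewrite /frame_base; case: (std h).
    by exists 1; rewrite ?adjmx1 ?mulmx1 // oner_neq0.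
  exists ((oddlen (z (hend h)))%:R ^+ 2); first by rewrite reflmx_adj reflmx_sqr.
  move=> z0; rewrite expf_neq0 // pnatr_eq0.
  by apply: contraTneq (odd_oddlen z0) => ->.
have [c cE c0] := base; have [z0|z0] := posnP (z (hend h)).
  exists 1; first exact: oner_neq0.
  apply/matrixP => k; exfalso; have := leq_trans (ltn_ord k) (hrank_le Q z h).
  by rewrite z0.
exists c; first exact: c0.
rewrite frame_unlock adjmxM mulmxA -(mulmxA _ _ (frame_base h)) cE.
by rewrite mul_mx_scalar -scalemxAl sel1 scalemx1.
Qed.

Lemma frame_real h : overK true (frame h).
Proof.
rewrite frame_unlock.
apply: overKM; last by move=> _; apply/realmxP/matrixP => i j; rewrite !mxE conjC_nat.
rewrite /frame_base; case: (std h); first exact: overK1.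
move=> _; apply/realmxP/matrixP => i j.
by rewrite mxE reflmxE rmorphB rmorphMn !rmorphM /= !conjC_nat.
Qed.

(** The shift by one keeps the singular values nonzero; being positive, they have distinct
    squares. *)
Definition frame_diag a : 'M[C]_(hrank a) := diag_mx (\row_k k.+1%:R).

Lemma frame_diag_adj a : (frame_diag a)^t* = frame_diag a.
Proof.
apply/matrixP => k l; rewrite !mxE rmorphMn /= conjC_nat eq_sym.
by case: eqP => [->|].
Qed.

(* The nonzero singular values of each matrix are distinct and its singular
   vectors are the chosen frames, so that every endomorphism has the frame
   vectors as eigenvectors. *)
Definition realizer : rep C Q := @Rep _ _ _ Q z (fun a =>
  frame (a, true) *m frame_diag a *m (frame (a, false))^t*).

Lemma repK_realizer : repK true realizer.
Proof.
move=> a; apply: overKM; last first.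
  by apply: overK_adj; exact: (@frame_real (a, false)).
apply: overKM; first exact: (@frame_real (a, true)).
by move=> _; apply/mxOverP => k l; rewrite !mxE rpredMn ?realn.
Qed.

(** The matrix of the arrow when [h] is its source half-edge and the adjoint otherwise, so that both
    directions are treated at once. *)
Definition hmap h : 'M[C]_(z (hend (hopp h)), z (hend h)) :=
  frame (hopp h) *m frame_diag h.1 *m (frame h)^t*.

Lemma hmap_adj h :
  (hmap h)^t* = frame h *m frame_diag h.1 *m (frame (hopp h))^t*.
Proof. exact: sandwich_adj (frame_diag_adj h.1). Qed.

Lemma hmap_hom (P : fam realizer realizer) h : homK false P ->
  P (hend (hopp h)) *m hmap h = hmap h *m P (hend h).
Proof.
move=> [P1 P2 _]; case: h => a []; last exact: P1.
rewrite -[hmap (a, true)]trmxCK hmap_adj; exact: P2.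
Qed.

(** [P] commutes with the Gram matrix of [hmap h], whose eigenvectors for nonzero eigenvalues are
    the columns of [frame h]. *)
Lemma frame_eigen (P : fam realizer realizer) h : homK false P ->
  exists e, P (hend h) *m frame h = frame h *m diag_mx e.
Proof.
move=> hP; have [c c0 cE] := frame_gram h.
have [c' c'0 c'E] := frame_gram (hopp h).
apply: (gram_eigen (d := \row_k (k.+1%:R ^+ 2)) cE c0).
- move=> k l; rewrite !mxE => /eqP; rewrite -!natrX eqr_nat eqn_exp2r // => /eqP[].
  exact: val_inj.
- by move=> k; rewrite mxE expf_neq0 // pnatr_eq0.
have BB : (hmap h)^t* *m hmap h =
    c' *: (frame h *m diag_mx (\row_k (k.+1%:R ^+ 2)) *m (frame h)^t*).
  rewrite (_ : diag_mx _ = frame_diag h.1 *m frame_diag h.1).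
    exact: sandwich_gram c'E (frame_diag_adj h.1).
  by rewrite mulmx_diag; congr diag_mx; apply/rowP => k; rewrite !mxE expr2.
have PB : P (hend h) *m ((hmap h)^t* *m hmap h) = (hmap h)^t* *m hmap h *m P (hend h).
  have := congr1 (fun M => M^t*) (hmap_hom h (homK_adj hP)).
  rewrite /= (adjmxM _ (hmap h)) (adjmxM (hmap h)) !trmxCK => E.
  by rewrite mulmxA -E -mulmxA (hmap_hom h hP) mulmxA.
move: PB; rewrite BB -scalemxAr -scalemxAl => /(congr1 (fun M => c'^-1 *: M)).
by rewrite !scalerA mulVf // !scale1r.
Qed.

Lemma std_column (P : fam realizer realizer) h (t : 'I_(z (hend h))) k :
  homK false P -> std h -> (k < hrank h.1)%N -> val t = th h k ->
  exists c, forall i, P (hend h) i t = c *+ (i == t).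
Proof.
move=> hP sh kr tk; have [e eE] := frame_eigen h hP.
exists (e 0 (Ordinal kr)) => i; have /matrixP/(_ i (Ordinal kr)) := eE.
rewrite frame_unlock /frame_base sh mul1mx (mul_selmx _ _ (t := t)) // => ->.
rewrite mul_mx_diag !mxE /= -tk (inj_eq val_inj).
by case: eqP => _; rewrite ?mul1r ?mul0r.
Qed.

Lemma refl_column (P : fam realizer realizer) h l (t : 'I_(z l)) k :
  hend h = l -> homK false P -> ~~ std h -> (k < hrank h.1)%N -> val t = th h k ->
  exists c, forall i, (P l *m reflmx C (z l)) i t = c * reflmx C (z l) i t.
Proof.
move=> hl hP /negPf sh kr; case: _ / hl t => t tk; have [e eE] := frame_eigen h hP.
exists (e 0 (Ordinal kr)) => i; have /matrixP/(_ i (Ordinal kr)) := eE.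
rewrite mul_mx_diag [RHS]mxE (frameE _ (k := Ordinal kr) tk).
rewrite frame_unlock /frame_base sh mulmxA (mul_selmx _ _ (t := t)) // => ->.
by rewrite mulrC.
Qed.

(** [h] supplies standard basis vectors and [h1] at least one reflected vector, so both kinds of
    eigenvectors demanded by [local_scalar] occur. *)
Lemma branch_scalar (P : fam realizer realizer) h h1 :
  homK false P -> (forall i, (P i)^t* = P i) ->
  (0 < hrank h.1)%N -> (0 < hrank h1.1)%N -> hend h1 = hend h ->
  (forall h', hend h' = hend h -> std h' = (h' == h)) -> h1 != h ->
  (forall t, (t < z (hend h))%N -> exists h' k,
     [/\ hend h' = hend h, (k < hrank h'.1)%N & th h' k = t]) ->
  exists c, P (hend h) = c%:M.
Proof.
move=> hP sP rh rh1 e1 stdE h1h cover.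
apply: (@local_scalar _ _ _
  (fun t => exists2 k, (k < hrank h.1)%N & val t = th h k)
  (fun t => exists h' k, [/\ hend h' = hend h, ~~ std h', (k < hrank h'.1)%N
     & val t = th h' k])) => //.
- by move=> t [k kr tk]; apply: std_column tk => //; rewrite stdE.
- by move=> t [h' [k [e' s' kr tk]]]; exact: refl_column tk.
- by exists (Ordinal (th_lt rh)), 0%N.
- have lt : (th h1 0 < z (hend h))%N by rewrite -e1; exact: th_lt.
  by exists (Ordinal lt), h1, 0%N; split=> //; rewrite stdE.
- move=> t; have [h' [k [e' kr tk]]] := cover t (ltn_ord t).
  have [s|s] := boolP (std h'); last by right; exists h', k; split.
  left; have hh : h' = h by apply/eqP; rewrite -stdE.
  by exists k; [rewrite -hh|move: tk; rewrite hh => ->].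
Qed.

Lemma hmap_neq0 h : (0 < hrank h.1)%N -> hmap h != 0.
Proof.
move=> rh; have [c c0 cE] := frame_gram h.
have [c' c'0 c'E] := frame_gram (hopp h).
apply/eqP => /(sandwich_eq0 c'E cE c'0 c0).
move=> /matrixP/(_ (Ordinal rh) (Ordinal rh)); rewrite !mxE eqxx mulr1n.
by move/eqP; rewrite pnatr_eq0.
Qed.

(** Full rank makes [frame h] square, hence invertible. This lets a scalar at the far end be pulled
    back through [hmap h]. *)
Lemma hmap_inj h m (X : 'M[C]_(z (hend h), m)) :
  (z (hend h) <= hrank h.1)%N -> hmap h *m X = 0 -> X = 0.
Proof.
move=> zr BX; have rz : hrank h.1 = z (hend h).
  by apply/eqP; rewrite eqn_leq zr hrank_le.
have [c c0 cE] := frame_gram h; have [c' c'0 c'E] := frame_gram (hopp h).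
have DX : frame_diag h.1 *m ((frame h)^t* *m X) = 0.
  exact: sandwich_mul_eq0 c'E c'0 BX.
have WX : (frame h)^t* *m X = 0.
  apply/matrixP => i j; have /matrixP/(_ i j) := DX.
  rewrite mul_diag_mx mxE [X in X * _]mxE [RHS]mxE => /eqP.
  by rewrite mulf_eq0 pnatr_eq0 [RHS]mxE => /eqP.
have WW : frame h *m (c^-1 *: (frame h)^t*) = 1%:M.
  by apply: mulmx1C_eq => //; rewrite -scalemxAl cE scale_scalar_mx mulVf.
by rewrite -[X]mul1mx -WW -mulmxA -scalemxAl WX scaler0 mulmx0.
Qed.

End Realization.

(** * Indecomposability of the realizing representations *)

Section Sufficiency.
Variables (C : numClosedFieldType) (p q : nat) (Q : quiver p q).

Lemma realize_connected (z : 'I_p -> nat) :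
  (exists i, z i <> 0%N) -> supp_connected Q z -> ~ supp_segment Q z ->
  (forall i, (z i <= ((\row_j z j) *m arrow_mx Q) ord0 i)%N) ->
  exists A : rep C Q, [/\ rdim A = z, repK true A & indecK false A].
Proof.
move=> [i0 /eqP zi0] conn nseg zM.
have cov l := index_cover (s := [seq h <- enum {: 'I_q * bool} | hend Q h == l])
  (r := fun h => hrank Q z h.1) (n := z l).
have [th thP] : exists th : 'I_q * bool -> nat -> nat, forall l,
    [/\ forall h k, hend Q h = l -> (k < hrank Q z h.1)%N -> (th h k < z l)%N,
        forall h k m, hend Q h = l -> (k < hrank Q z h.1)%N -> (m < hrank Q z h.1)%N ->
          th h k = th h m -> k = m
      & forall t, (t < z l)%N -> exists h k,
          [/\ hend Q h = l, (k < hrank Q z h.1)%N & th h k = t]].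
  have cov' l : exists th : 'I_q * bool -> nat -> nat,
    [/\ forall h k, hend Q h = l -> (k < hrank Q z h.1)%N -> (th h k < z l)%N,
        forall h k m, hend Q h = l -> (k < hrank Q z h.1)%N -> (m < hrank Q z h.1)%N ->
          th h k = th h m -> k = m
      & forall t, (t < z l)%N -> exists h k,
          [/\ hend Q h = l, (k < hrank Q z h.1)%N & th h k = t]].
    have mem h : (h \in [seq h <- enum {: 'I_q * bool} | hend Q h == l]) = (hend Q h == l).
      by rewrite mem_filter mem_enum andbT.
    have [|h||th [t1 t2 t3]] := cov l.
    - by rewrite filter_uniq // enum_uniq.
    - by rewrite mem => /eqP <-; exact: hrank_le.
    - rewrite big_filter big_enum_cond; exact: half_edge_sum.
    exists th; split=> [h k /eqP|h k m /eqP|t /t3[h [k [hl kr tk]]]].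
    - by rewrite -mem; exact: t1.
    - by rewrite -mem; exact: t2.
    - by exists h, k; split=> //; apply/eqP; rewrite -mem.
  (* Each half-edge lies at exactly one vertex, so the coverings chosen vertex by vertex combine
     into one function. *)
  have [f fP] := choice cov'; exists (fun h => f (hend Q h) h) => l.
  have [f1 f2 f3] := fP l; split=> [h k e|h k m e|t /f3[h [k [e kr tk]]]].
  - by rewrite e; exact: f1.
  - by rewrite e; exact: f2.
  - by exists h, k; rewrite e; split.
have th_lt h k : (k < hrank Q z h.1)%N -> (th h k < z (hend Q h))%N.
  by have [t1 _ _] := thP (hend Q h); exact: t1.
have th_inj h k m : (k < hrank Q z h.1)%N -> (m < hrank Q z h.1)%N ->
    th h k = th h m -> k = m.
  by have [_ t2 _] := thP (hend Q h); exact: t2.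
pose std h := Some h == hpick Q z (hend Q h).
pose A := realizer C Q z th std.
exists A; split=> //; first exact: repK_realizer.
apply: proj_indecK => [a //|A0|P hP sP PP].
  by have := A0 i0; rewrite /= => /eqP; rewrite (negPf zi0).
have pick l := @hpickP _ _ Q z l zM.
(* Where [P] is not scalar, no second half-edge of positive rank can join the picked one:
   [branch_scalar] would apply. *)
have unique h : hpick Q z (hend Q h) = Some h ->
    (forall c, P (hend Q h) <> c%:M) ->
    forall h', hend Q h' = hend Q h -> (0 < hrank Q z h'.1)%N -> h' = h.
  move=> ph nsc h' e' r'; apply: contrapT => /eqP ne.
  have [|h2 [ph2 _ r2]] := pick (hend Q h).
    by rewrite -lt0n -e'; exact: leq_trans r' (hrank_le _ _ h').
  have e2 : h2 = h by case: ph2; rewrite ph => -[].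
  have [|||c] := branch_scalar th_lt th_inj hP sP (h := h) (h1 := h') _ r' e' _ ne;
    last exact: nsc.
  - by rewrite -e2.
  - by move=> k ek; rewrite /std ek ph.
  by have [_ _] := thP (hend Q h).
(* At a nonscalar vertex the picked half-edge is alone, so its rank is the full dimension and a
   scalar at its other end could be pulled back. If that end is not scalar either, both ends are
   leaves and the support is a segment. *)
have scalar l : z l != 0%N -> exists c, P l = c%:M.
  move=> zl; apply: contrapT => nsc; have [h [ph hl rh]] := pick l zl.
  have u1 : forall h', hend Q h' = hend Q h -> (0 < hrank Q z h'.1)%N -> h' = h.
    by apply: unique; rewrite hl // => c Pc; apply: nsc; exists c.
  have zr : (z (hend Q h) <= hrank Q z h.1)%N.
    apply: leq_trans (half_edge_sum zM _) _; rewrite (bigD1 h) //= big1 ?addn0 //.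
    move=> h' /andP[/eqP e' ne]; apply/eqP; rewrite -leqn0 leqNgt; apply/negP => r'.
    by rewrite (u1 h' e' r') eqxx in ne.
  have [[c Pc]|nsc'] := EM (exists c, P (hend Q (hopp h)) = c%:M).
    apply: nsc; exists c; rewrite -hl; apply/eqP; rewrite -subr_eq0; apply/eqP.
    apply: (hmap_inj th_lt th_inj (std := std)) zr _.
    by rewrite mulmxBr -(hmap_hom _ hP) Pc scalar_mxC subrr.
  apply: nseg; apply: (two_leaves_segment (h := h)) => // h' e' r'.
  have zl' : z (hend Q (hopp h)) != 0%N.
    by rewrite -lt0n; exact: leq_trans rh (hrank_le _ _ (hopp h)).
  have [h2 [ph2 hl2 r2]] := pick _ zl'.
  have u2 : forall h', hend Q h' = hend Q h2 -> (0 < hrank Q z h'.1)%N -> h' = h2.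
    by apply: unique; rewrite hl2 // => c Pc; apply: nsc'; exists c.
  by rewrite (u2 h') ?hl2 // (u2 (hopp h)) ?hl2.
have [c Pc] := scalar i0 zi0.
(* Two scalars intertwined by a nonzero matrix coincide, and connectedness spreads the scalar of
   [i0] over the support. *)
have all l : z l != 0%N -> P l = c%:M.
  move=> zl; apply: (connect_closed (S := fun l => P l = c%:M) _ Pc (conn i0 l _ _));
    rewrite ?inE //.
  move=> u v Pu /supp_adjP[h [hu hv rh]].
  have zv : z v != 0%N by rewrite -lt0n -hv; exact: leq_trans rh (hrank_le _ _ (hopp h)).
  have [d Pd] := scalar v zv; rewrite Pd; congr (_%:M).
  have := hmap_hom h hP.
  have -> : P (hend Q (hopp h)) = d%:M by rewrite hv.
  have -> : P (hend Q h) = c%:M by rewrite hu.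
  rewrite mul_scalar_mx mul_mx_scalar => /eqP.
  rewrite -subr_eq0 -scalerBl scalemx_eq0 subr_eq0 => /orP[/eqP//|].
  have /negPf -> // : hmap C Q z th std h != 0 by exact: hmap_neq0.
have cc : c = 0 \/ c = 1.
  have zi0' : (0 < z i0)%N by rewrite lt0n.
  have := PP i0; rewrite Pc -scalar_mxM => /matrixP/(_ (Ordinal zi0') (Ordinal zi0')).
  rewrite !mxE eqxx !mulr1n => /eqP.
  rewrite -subr_eq0 -{3}[c]mulr1 -mulrBr mulf_eq0 subr_eq0.
  by case/orP => /eqP; [left|right].
have empty l (M N : 'M[C]_(z l)) : z l = 0%N -> M = N.
  move=> z0; apply/matrixP => i; exfalso.
  by have := leq_ltn_trans (leq0n _) (ltn_ord i); rewrite z0.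
case: cc => c01; [left|right] => l; have [z0|z0] := eqVneq (z l) 0%N.
- exact: empty.
- by rewrite all // c01 raddf0.
- exact: empty.
- by rewrite all // c01.
Qed.

Lemma idempotent_small n (M : 'M[C]_n) : (n <= 1)%N -> M *m M = M -> M = 0 \/ M = 1%:M.
Proof.
case: n M => [|[|//]] M _ MM; first by left; apply/matrixP => -[].
have := congr1 (fun N : 'M_1 => N 0 0) MM; rewrite mxE big_ord1 => /eqP.
rewrite -subr_eq0 -{3}[M 0 0]mulr1 -mulrBr mulf_eq0 subr_eq0 => /orP[]/eqP M00.
  by left; rewrite [LHS]mx11_scalar M00 raddf0.
by right; rewrite [LHS]mx11_scalar M00.
Qed.

(** Serves [e_i], and [e_i + e_j] with distinct [i], [j]. With all entries 1 and dimensions at most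
    1, a projection endomorphism is 0 or 1 at each vertex, and an arrow between two support vertices
    equates its values there. *)
Lemma realize_small (z : 'I_p -> nat) : (exists i, z i = 1%N) -> (forall i, (z i <= 1)%N) ->
  (forall i j, z i = 1%N -> z j = 1%N -> i <> j ->
     exists a, (src Q a = i /\ tgt Q a = j) \/ (src Q a = j /\ tgt Q a = i)) ->
  exists A : rep C Q, [/\ rdim A = z, repK true A & indecK false A].
Proof.
move=> [i0 zi0] z1 edge.
pose A := @Rep C p q Q z (fun a => const_mx 1); exists A; split=> //.
  by move=> a _; apply/mxOverP => i j; rewrite mxE real1.
apply: proj_indecK => [a //|A0|P hP sP PP]; first by have := A0 i0; rewrite /= zi0.
have P01 i : P i = 0 \/ P i = 1%:M by exact: idempotent_small (z1 i) (PP i).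
have nz m n : m = 1%N -> n = 1%N -> (const_mx 1 : 'M[C]_(m, n)) <> 0.
  by move=> -> -> /matrixP/(_ 0 0); rewrite !mxE => /eqP; rewrite oner_eq0.
have [P1 P2 _] := hP.
have prop a : z (src Q a) = 1%N -> z (tgt Q a) = 1%N ->
    (P (src Q a) = 0 <-> P (tgt Q a) = 0).
  move=> zs zt; have := P1 a => /= E; split=> P0.
    case: (P01 (tgt Q a)) => // P1'; move: E; rewrite P1' P0 mul1mx mulmx0.
    by move/nz => /(_ zt zs).
  case: (P01 (src Q a)) => // P1'; move: E; rewrite P1' P0 mul0mx mulmx1.
  by move/esym/nz => /(_ zt zs).
have same i j : z i = 1%N -> z j = 1%N -> P i = 0 -> P j = 0.
  move=> zi zj Pi; have [<-//|/eqP ij] := eqVneq i j.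
  by have [a [[e1 e2]|[e1 e2]]] := edge i j zi zj ij; subst i j; apply/prop.
have zero i : z i <> 1%N -> forall M : 'M[C]_(z i), M = 0.
  move=> zi M; apply/matrixP => k; exfalso; have := leq_ltn_trans (leq0n _) (ltn_ord k).
  by have := z1 i; case: (z i) zi => [|[]].
have [P0|P0] := P01 i0; [left|right] => i.
  by have [zi|zi] := EM (z i = 1%N); [exact: same zi0 zi P0|exact: zero].
have [zi|zi] := EM (z i = 1%N); last by rewrite [LHS]zero // [RHS]zero.
case: (P01 i) => // Pi; have := same _ _ zi zi0 Pi; rewrite P0 => /(congr1 mxrank).
by rewrite mxrank0 mxrank1 /= zi0.
Qed.

Lemma DQ_realize (z : 'I_p -> nat) : DQ Q z ->
  exists A : rep C Q, [/\ rdim A = z, repK true A & indecK false A].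
Proof.
case=> [[i ->]|[i [j [mij ->]]]|[nz conn _ nseg zM]]; last exact: realize_connected.
  apply: realize_small => [|k|k l]; rewrite /unit_vec.
  - by exists i; rewrite eqxx.
  - by case: (k == i).
  - by case: eqP => // -> _; case: eqP => // -> _ [].
have [ij|ij] := eqVneq i j; last first.
  have ex : exists a, (src Q a = i /\ tgt Q a = j) \/ (src Q a = j /\ tgt Q a = i).
    move: mij; rewrite mxE /arrow_count => /eqP/cards1P[a aE].
    have : a \in [set a]%SET by rewrite inE.
    rewrite -aE inE => /orP[]/andP[/eqP ? /eqP ?]; exists a; by [left|right].
  apply: realize_small => [|k|k l]; rewrite /unit_vec.
  - by exists i; rewrite eqxx (negPf ij).
  - by have [->|_] := eqVneq k i; [rewrite (negPf ij)|case: (k == j)].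
  have [->|ki] := eqVneq k i; have [->|li] := eqVneq l i => //=.
  - rewrite (negPf ij) => _; case: (l =P j) => // -> _ _.
    by have [a [[? ?]|[? ?]]] := ex; exists a; [left|right].
  - case: (k =P j) => // -> _ _ _.
    by have [a [[? ?]|[? ?]]] := ex; exists a; [right|left].
  - by case: (k =P j) => // -> _; case: (l =P j) => // -> _ [].
(* The remaining vector is [2 e_i] at a vertex with exactly one loop. The loop contributes 2 to
   [(zM)_i], so the general construction applies. *)
subst j; move: mij; rewrite mxE /arrow_count => /eqP/cards1P[a aE].
have [sa ta] : src Q a = i /\ tgt Q a = i.
  have : a \in [set a]%SET by rewrite inE.
  by rewrite -aE inE => /orP[]/andP[/eqP -> /eqP ->].
pose y k := (unit_vec i k + unit_vec i k)%N.
have zE k : y k = (if k == i then 2 else 0)%N.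
  by rewrite /y /unit_vec; case: (k == i).
apply: (realize_connected (z := y)).
- by exists i; rewrite zE eqxx.
- move=> k l; rewrite !inE !zE; case: (k =P i) => // -> _; case: (l =P i) => // -> _.
  exact: connect0.
- move=> [/eqP]; rewrite (_ : supp_vertices y = [set i]%SET) ?cards1 //.
  by apply/setP => k; rewrite !inE zE; case: (k =P i).
- move=> k; rewrite row_arrow_mx zE; case: (k =P i) => // ->.
  by rewrite (bigD1 a) //= sa eqxx ta zE eqxx leq_addr.
Qed.

End Sufficiency.

Local Close Scope sesquilinear_scope.
Local Open Scope classical_set_scope.

Theorem theorem4p1 (R : realType) (p q : nat) (Q : quiver p q) :
  [/\ (* (a) *)
      forall A B : rep R[i] Q, euclidean A -> euclidean B ->
        (R_isometric A B <-> isometric A B),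
      (* (b) *)
      [/\ forall A : rep R[i] Q, euclidean A ->
            exists (n : nat) (B : 'I_n -> rep R[i] Q),
              (forall k, R_indecomposable (B k)) /\
              R_isometric A (\big[@dsum _ _ _ Q/rep0 _ Q]_(k < n) B k),
          forall A : rep R[i] Q, euclidean A ->
            forall (m n : nat) (B : 'I_m -> rep R[i] Q) (B' : 'I_n -> rep R[i] Q),
              (forall k, R_indecomposable (B k)) ->
              (forall k, R_indecomposable (B' k)) ->
              R_isometric A (\big[@dsum _ _ _ Q/rep0 _ Q]_(k < m) B k) ->
              R_isometric A (\big[@dsum _ _ _ Q/rep0 _ Q]_(k < n) B' k) ->
              exists s : 'I_m -> 'I_n,
                bijective s /\ forall k, R_isometric (B k) (B' (s k))
        & forall I I1 : set (rep R[i] Q), is_ind I -> is_ind1 I I1 ->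
            is_ind_R (ind0 I `|` [set realify A | A in I1])]
    & (* (c) *)
      [set rdim A | A in [set A : rep R[i] Q | R_indecomposable A]] =
        [set rdim A | A in [set A : rep R[i] Q | indecomposable A]] /\
      [set rdim A | A in [set A : rep R[i] Q | R_indecomposable A]] = DQ Q].
Proof.
split.
- move=> A B /euclideanE rA /euclideanE rB.
  split=> [/R_isometricE iso|/isometricE iso].
    exact/isometricE/(isoK_false iso).
  exact/R_isometricE/isoK_true_false.
- split.
  + move=> A /euclideanE/exists_decomposition[n [B [iB iso]]].
    exists n, B; split; last exact/R_isometricE.
    by move=> k; exact/R_indecomposableE.
  + move=> A _ m n B B' iB iB' /R_isometricE isoB /R_isometricE isoB'.
    have [k|k|s [bs isos]] :=
        isoK_unique (K := true) (F := B) (G := B') _ _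
          (isoK_trans (isoK_sym isoB) isoB').
    * exact/R_indecomposableE.
    * exact/R_indecomposableE.
    * by exists s; split=> // k; exact/R_isometricE.
  + by move=> I I1; exact: ind_R_complete.
(* A Euclidean representation indecomposable over C is also R-indecomposable, so one realization
   serves both sets of dimensions. *)
- have realize z : DQ Q z -> exists2 A : rep R[i] Q,
      R_indecomposable A /\ indecomposable A & rdim A = z.
    move=> /(DQ_realize R[i])[A [dA rA iA]]; exists A => //; split.
      exact/R_indecomposableE/indecK_true.
    exact/indecomposableE.
  split; apply/seteqP; split=> [_ [A iA <-]|z].
  + have [|A' [_ iA'] dA'] := realize (rdim A); last by exists A'.
    by move/R_indecomposableE: iA; exact: indecK_DQ.
  + move=> [A /indecomposableE/indecK_DQ iA <-].
    by have [A' [iA' _] dA'] := realize _ iA; exists A'.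
  + by move/R_indecomposableE: iA; exact: indecK_DQ.
  + by move=> /realize[A [iA _] dA]; exists A.
Qed.
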